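(* Let $p_n(u)\in\mathbb Q[u]$ be defined by $p_{-1}=0$, $p_0=1$ and \[ (n+1)^2p_{n+1}(u)+p_n'(u)(u^2-u)-nu\,p_n(u)+\frac{u\,p_{n-1}(u)}{4}=0\qquad(n\ge0), \] and let $H(u,v)=\sum_{n\geq 0}n!^2p_n(u)v^n$ (a formal power series in $u,v$). Then there are rational functions $h_n(v)\in\mathbb Q(v)$, each regular at $v=0$, such that \[ H(u,v)=\sum_{n\geq 0}h_n(v)u^n \] (as formal power series, each $h_n$ replaced by its Taylor expansion at $v=0$). These satisfy $h_0(v)=1$ and, for $n>0$, \[ \frac{h_n(v)}{v}-nh_n(v)+(n-1)h_{n-1}(v)-vh_{n-1}'(v)+\frac{v\big(v(vh_{n-1}(v))'\big)'}{4}=0. \] For every integer $n\ge1$, $h_n(v)$ has a pole at $v=\frac1n$ if and only if $n$ is a sum of two squares of integers; more precisely \[ \underset{v=1/n}{\mathrm{Res}}\,h_n(v)=\frac{(-1)^{n-1}r_2(n)}{n16^n}. \]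
   Context: $r_2(n)=\#\{(a,b)\in\mathbb Z^2:a^2+b^2=n\}$. *)

(* Defs.v *)
From HB Require Import structures.
From mathcomp Require Import all_boot all_order all_algebra.
From mathcomp Require Import finmap.
From mathcomp Require Import zify ring.
From mathcomp Require Import boolp classical_sets functions cardinality.

Set Implicit Arguments.
Unset Strict Implicit.
Unset Printing Implicit Defensive.

Import Order.TTheory GRing.Theory Num.Theory.
Local Open Scope ring_scope.

Section RationalFunctions.
Variable F : fieldType.
Implicit Types (a b q : {poly F}) (f : {fraction {poly F}}) (c : F).

Definition rf_of (a : {poly F}) : {fraction {poly F}} := FracField.tofrac a.

(* A representative of f, not necessarily in lowest terms. The definitions     *)
(* below do not depend on this choice: see rf_derivE and laurent_coefE.        *)
Definition rf_num f : {poly F} := \n_(repr f).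
Definition rf_den f : {poly F} := \d_(repr f).

Definition rf_deriv f : {fraction {poly F}} :=
  rf_of ((rf_num f)^`() * rf_den f - rf_num f * (rf_den f)^`())
    / rf_of (rf_den f ^+ 2).

Definition regular_at c f : Prop :=
  exists a b, b.[c] != 0 /\ f = rf_of a / rf_of b.

Definition has_pole c f : Prop := ~ regular_at c f.

(* Coefficients of the formal power series a / b, by long division; they are   *)
(* meaningful when b`_0 != 0.                                                  *)
Fixpoint psdiv_seq a b (n : nat) : seq F :=
  if n is m.+1 then
    let s := psdiv_seq a b m in
    rcons s ((a`_m - \sum_(i < m) s`_i * b`_(m - i)) / b`_0)
  else [::].

Definition psdiv a b (n : nat) : F := (psdiv_seq a b n.+1)`_n.

(* The coefficient of (v - c)^k in the Laurent expansion of f at c. With m the *)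
(* multiplicity of c as a root of the denominator b, it is the coefficient of  *)
(* t^(k + m) in the power series a(c + t) / (b(c + t) / t^m).                  *)
Definition laurent_coef c f (k : int) : F :=
  let m := mup c (rf_den f) in
  if k + m%:Z is Posz n then
    psdiv (rf_num f \Po ('X + c%:P))
          ((rf_den f %/ ('X - c%:P) ^+ m) \Po ('X + c%:P)) n
  else 0.

Definition taylor_coef c f (n : nat) : F := laurent_coef c f n%:Z.

Definition residue c f : F := laurent_coef c f (- 1).

Lemma rf_of_eq a b : (rf_of a = rf_of b) <-> a = b.
Proof.
by split=> [|-> //]; move=> /eqP; rewrite /rf_of tofrac_eq => /eqP.
Qed.

Lemma rf_den_neq0 f : rf_den f != 0.
Proof. exact: denom_ratioP. Qed.

Lemma rf_of_neq0 a : a != 0 -> rf_of a != 0.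
Proof. by move=> a0; rewrite /rf_of tofrac_eq0. Qed.

Lemma rf_numden f a b : b != 0 -> f = rf_of a / rf_of b ->
  rf_num f * b = a * rf_den f.
Proof.
move=> b0 Ef.
have E1 : f * rf_of (rf_den f) = rf_of (rf_num f).
  rewrite /rf_num /rf_den /rf_of; set x := repr f.
  have -> : f = \pi_({fraction {poly F}})%qT x by rewrite /x reprK.
  unlock FracField.tofrac.
  rewrite /GRing.mul /= -FracField.pi_mul; apply/eqmodP => /=.
  have x0 := denom_ratioP x.
  rewrite FracField.equivfE /FracField.mulf !numden_Ratio ?mulf_neq0 ?oner_neq0 //.
  by rewrite !mulr1 mulrC.
apply/rf_of_eq; rewrite /rf_of !tofracM -/(rf_of _) -E1 Ef mulrAC divfK ?rf_of_neq0 //.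
Qed.

Lemma rf_derivE a b : b != 0 ->
  rf_deriv (rf_of a / rf_of b) =
    rf_of (a^`() * b - a * b^`()) / rf_of (b ^+ 2).
Proof.
move=> b0; have E := rf_numden b0 (erefl (rf_of a / rf_of b)).
rewrite /rf_deriv; set f := rf_of a / rf_of b in E *.
have d0 := rf_den_neq0 f; move: (rf_num f) (rf_den f) E d0 => n d E d0.
have E' : n^`() * b + n * b^`() = a^`() * d + a * d^`().
  by rewrite -!derivM E.
apply/eqP; rewrite eqr_div ?rf_of_neq0 ?expf_neq0 // /rf_of -!tofracM.
apply/eqP; congr FracField.tofrac.
have -> : (n^`() * d - n * d^`()) * b ^+ 2
        = (n^`() * b) * d * b - (n * b) * d^`() * b by ring.
have -> : n^`() * b = a^`() * d + a * d^`() - n * b^`() by rewrite -E'; ring.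
have -> : (a^`() * d + a * d^`() - n * b^`()) * d * b =
  (a^`() * d + a * d^`()) * d * b - (n * b) * b^`() * d by ring.
by rewrite E; ring.
Qed.

Lemma size_psdiv_seq a b n : size (psdiv_seq a b n) = n.
Proof. by elim: n => //= n IH; rewrite size_rcons IH. Qed.

Lemma nth_psdiv_seq a b n i : (i < n)%N -> (psdiv_seq a b n)`_i = psdiv a b i.
Proof.
elim: n => // n IH; rewrite ltnS leq_eqVlt => /orP[/eqP -> //|lt_in].
by rewrite /= nth_rcons size_psdiv_seq lt_in IH.
Qed.

Lemma psdivP a b n : b`_0 != 0 ->
  \sum_(i < n.+1) psdiv a b i * b`_(n - i) = a`_n.
Proof.
move=> b0; rewrite big_ord_recr /= subnn {2}/psdiv /= nth_rcons.
rewrite size_psdiv_seq ltnn eqxx divfK // addrC.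
rewrite [X in _ - X](eq_bigr (fun i : 'I_n => psdiv a b i * b`_(n - i))) ?subrK //.
by move=> i _; rewrite nth_psdiv_seq.
Qed.

Lemma psdiv_unique a b (s : nat -> F) : b`_0 != 0 ->
  (forall n, \sum_(i < n.+1) s i * b`_(n - i) = a`_n) -> s =1 psdiv a b.
Proof.
move=> b0 Hs n; elim/ltn_ind: n => n IH.
have := Hs n; rewrite -(psdivP a n b0) !big_ord_recr /= subnn.
rewrite (eq_bigr (fun i : 'I_n => psdiv a b i * b`_(n - i))); last first.
  by move=> i _; rewrite IH.
by move=> /addrI /(mulIf b0).
Qed.

Lemma psdivMr a b q : b`_0 != 0 -> q`_0 != 0 ->
  psdiv (a * q) (b * q) =1 psdiv a b.
Proof.
move=> b0 q0 n; symmetry; apply: psdiv_unique n.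
  by rewrite coef0M mulf_neq0.
move=> n; pose t := \poly_(i < n.+1) psdiv a b i.
have tb k : (k <= n)%N -> (t * b)`_k = a`_k.
  move=> le_kn; rewrite coefM -(psdivP a k b0); apply: eq_bigr => i _.
  by rewrite coef_poly (leq_trans (ltn_ord i)).
transitivity (t * (b * q))`_n.
  rewrite coefM; apply: eq_bigr => i _.
  by rewrite coef_poly ltn_ord.
rewrite mulrA !coefM; apply: eq_bigr => i _.
by rewrite tb // -ltnS.
Qed.

Lemma psdiv_cross a1 b1 a2 b2 : b1`_0 != 0 -> b2`_0 != 0 ->
  a1 * b2 = a2 * b1 -> psdiv a1 b1 =1 psdiv a2 b2.
Proof.
move=> h1 h2 E n; rewrite -(psdivMr a1 h1 h2) E [b1 * b2]mulrC.
by rewrite psdivMr.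
Qed.

Lemma psdivXM a b m n : b`_0 != 0 ->
  psdiv ('X^m * a) b n = if (n < m)%N then 0 else psdiv a b (n - m).
Proof.
move=> b0; symmetry.
apply: (psdiv_unique (s := fun n => if (n < m)%N then 0 else psdiv a b (n - m)))
  => // {}n.
rewrite coefXnM; case: ltnP => [lt_nm | le_mn].
  by apply: big1 => i _; rewrite (leq_trans (ltn_ord i)) ?mul0r.
rewrite -(psdivP a (n - m) b0) -(big_mkord xpredT
  (fun i => (if (i < m)%N then 0 else psdiv a b (i - m)) * b`_(n - i))).
rewrite (@big_cat_nat _ _ _ m) //=; last exact: leqW.
rewrite big_nat big1 ?add0r => [|i /andP[_ ->]]; last by rewrite mul0r.
rewrite -{1}(add0n m) big_addn subSn // big_mkord; apply: eq_bigr => i _.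
by rewrite ltnNge leq_addl addnK addnC subnDA.
Qed.

(* In particular residue c f = 0 whenever f is regular at c.                   *)
Lemma laurent_coefE c a b m (k : int) : b.[c] != 0 ->
  laurent_coef c (rf_of a / rf_of (('X - c%:P) ^+ m * b)) k =
    if k + m%:Z is Posz n then psdiv (a \Po ('X + c%:P)) (b \Po ('X + c%:P)) n
    else 0.
Proof.
move=> bc; have b0 : b != 0 by apply: contraNneq bc => ->; rewrite horner0.
have Xm0 j : ('X - c%:P) ^+ j != 0 by rewrite expf_neq0 ?polyXsubC_eq0.
have Xb0 := mulf_neq0 (Xm0 m) b0.
set f := (_ / _); have E := rf_numden Xb0 (erefl f).
rewrite /laurent_coef; have d0 := rf_den_neq0 f.
move: (rf_num f) (rf_den f) E d0 => N D E D0 {f}.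
set M := mup c D; set B := D %/ _.
have DE : D = B * ('X - c%:P) ^+ M by rewrite divpK // -mup_geq.
have Bc : B.[c] != 0.
  apply/negP => /factor_theorem[B' EB].
  have : (M.+1 <= M)%N by rewrite {2}/M mup_geq // DE EB -mulrA -exprS dvdp_mull.
  by rewrite ltnn.
have sh (q : {poly F}) : (q \Po ('X + c%:P))`_0 = q.[c].
  by rewrite -horner_coef0 horner_comp !hornerE.
have XE j : (('X - c%:P) ^+ j) \Po ('X + c%:P) = 'X^j.
  by rewrite rmorphXn /= comp_polyB comp_polyX comp_polyC addrK.
have {}E : ('X^m * (N \Po ('X + c%:P))) * (b \Po ('X + c%:P))
    = ('X^M * (a \Po ('X + c%:P))) * (B \Po ('X + c%:P)).
  have /(congr1 (fun q => q \Po ('X + c%:P))) := E.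
  rewrite DE !comp_polyM !XE => E'.
  by rewrite -mulrA mulrCA E'; ring.
have hb : (b \Po ('X + c%:P))`_0 != 0 by rewrite sh.
have hB : (B \Po ('X + c%:P))`_0 != 0 by rewrite sh.
have H n := psdiv_cross hB hb E n.
clearbody B M.
case Ek: (k + M%:Z) => [n1|n1]; case El: (k + m%:Z) => [n2|n2] //.
- have e : (n1 + m = n2 + M)%N by lia.
  have := H (n1 + m)%N; rewrite !psdivXM //.
  by rewrite ltnNge leq_addl addnK e ltnNge leq_addl addnK.
- have := H (n1 + m)%N; rewrite !psdivXM // ltnNge leq_addl /= addnK => ->.
  by rewrite ifT //; lia.
- have := H (n2 + M)%N; rewrite !psdivXM // [(_ < M)%N]ltnNge leq_addl /= addnK => <-.
  by rewrite ifT //; lia.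
Qed.

End RationalFunctions.

(* A power series in u, v is given by its coefficients: (i, j) stands for the  *)
(* coefficient of u^i v^j. The sequence p is indexed by int to include p_{-1}. *)
Definition Hseries (p : int -> {poly rat}) (i j : nat) : rat :=
  (j`!%:R) ^+ 2 * (p j%:Z)`_i.

Definition sq_pairs (n : nat) : set (int * int) :=
  [set ab | ab.1 ^+ 2 + ab.2 ^+ 2 = n%:Z]%classic.

Definition r2 (n : nat) : nat := #|` fset_set (sq_pairs n)|.

Lemma finite_sq_pairs n : finite_set (sq_pairs n).
Proof.
pose s : seq int := [seq i%:Z - n%:Z | i <- iota 0 (n.*2.+1)].
have ins (a b : int) : a ^+ 2 + b ^+ 2 = n%:Z -> a \in s.
  move=> e; have [h1 h2] : - n%:Z <= a /\ a <= n%:Z by split; nia.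
  apply/mapP; exists (absz (a + n%:Z)); last by lia.
  by rewrite mem_iota; lia.
apply: (@sub_finite_set _ _ [set` [seq (a, b) | a <- s, b <- s]]%classic).
  case=> a b /= e; suff : (a, b) \in [seq (a, b) | a <- s, b <- s] by [].
  by apply: allpairs_f; [exact: ins e | apply: (ins b a); rewrite addrC].
exact: finite_seq.
Qed.

(* Main.v *)
Require Import Defs.
From HB Require Import structures.
From mathcomp Require Import all_boot all_order all_algebra.
From mathcomp Require Import finmap zify ring lra.
From mathcomp Require Import boolp classical_sets functions cardinality.
Set Implicit Arguments.
Unset Strict Implicit.
Unset Printing Implicit Defensive.
Import Order.TTheory GRing.Theory Num.Theory.
Local Open Scope ring_scope.

(* Put P_n = n!^2 p_n, so that h_m is the generating series of the m-th        *)
(* coefficients of the P_n. Let x = q^(1/4), D = x d/dx = 4 q d/dq, and        *)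
(*   u = theta_2^4 / theta_3^4,  g = theta_3^-4,  c = theta_4^2,  e = 1 / c.   *)
(* Since u (1 - u) = g D u / 4, evaluating the polynomials P_n at u turns the  *)
(* recurrence into one in the differential ring of power series in x. The      *)
(* characteristics of the PDE behind it integrate to the closed form           *)
(*   4^n P_n(u) = e sum_i i! C(n, i)^2 g^(n - i) beta^i D^(n - i) c            *)
(* with beta = g D e / e, which follows by induction from first-order          *)
(* differential equations relating u, g, e and beta (the Halphen system).      *)
(* Both sides are then compared in degree x^(4 m), as sequences in n. On the   *)
(* left we get 16^m [u^m] P_n plus a combination of the [u^i] P_n with i < m;  *)
(* on the right, the term i = 0 contributes (-1)^m r_2(m) m^n and all the rest *)
(* consists of polynomials in n times k^n with k < m. Hence, by induction on   *)
(* m, h_m is (-1)^m r_2(m) / 16^m / (1 - m v) plus a rational function without *)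
(* poles at 1/k for k >= m.                                                    *)
(*   The theta identities are elementary: the rotation (s, t) |-> (s+t, s-t)   *)
(* of Z^2 gives doubling formulas x |-> x^2 for quadratic expressions in the   *)
(* theta constants and their derivatives, and Jacobi's formula theta_1' =      *)
(* theta_2 theta_3 theta_4 and the Halphen system hold because their defects   *)
(* satisfy doubling equations with 0 as only solution.                         *)

(** * Formal power series *)

(** A pole of h_n at 1/n shows in the growth of its Taylor coefficients j |-> [u^n] P_j: a term k
    n^j there is a summand k / (1 - n v) of h_n, with residue -k / n ([series_pole]). To find this
    term, P_j is evaluated at the modular function u = 16 x^4 + ..., where [scaled_eval] expresses
    it through the derivatives D^i (theta4^2). Applying D^i multiplies the coefficient (-1)^k r_2(k)
    of x^(4k) in theta4^2 ([theta4_sqr_coef]) by (4k)^i; after division by powers of 4, r_2(k) thus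
    becomes the amplitude of an exponential with base k. [tame_scaled_coef] isolates the exponential
    with the largest base by induction on the power of u. The differential equations behind the
    closed form are collected in [modular_system], which rests on Jacobi's formula [theta1E] and on
    [theta_halphen]. The h_n are defined by solving the stated recurrence ([hrat]), and
    [hrat_series] identifies their expansions with those of H. *)

Record fps (R : Type) := Fps { fcoef :> nat -> R }.

Lemma fpsP (R : Type) (f g : fps R) : (forall n, f n = g n) -> f = g.
Proof. by case: f g => f [g] /= fg; congr Fps; apply/funext. Qed.

HB.instance Definition _ (R : Type) := gen_eqMixin (fps R).
HB.instance Definition _ (R : Type) := gen_choiceMixin (fps R).

Section FpsRing.
Variable R : comNzRingType.
Implicit Types (f g h : fps R) (p q : {poly R}).

Definition fps_add f g := Fps (fun n => f n + g n).
Definition fps_opp f := Fps (fun n => - f n).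

Fact fps_addA : associative fps_add.
Proof. by move=> f g h; apply: fpsP => n /=; rewrite addrA. Qed.
Fact fps_addC : commutative fps_add.
Proof. by move=> f g; apply: fpsP => n /=; rewrite addrC. Qed.
Fact fps_add0 : left_id (Fps (fun=> 0)) fps_add.
Proof. by move=> f; apply: fpsP => n /=; rewrite add0r. Qed.
Fact fps_addN : left_inverse (Fps (fun=> 0)) fps_opp fps_add.
Proof. by move=> f; apply: fpsP => n /=; rewrite addNr. Qed.

HB.instance Definition _ :=
  GRing.isZmodule.Build (fps R) fps_addA fps_addC fps_add0 fps_addN.

Definition fps_of_poly p : fps R := Fps (fun n => p`_n).
Definition fps_mul f g := Fps (fun n => \sum_(i < n.+1) f i * g (n - i)%N).

(** A coefficient of a product depends on finitely many coefficients, so the ring laws are inherited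
    from polynomials by truncation. *)
Definition agree N p f := forall n, (n <= N)%N -> p`_n = f n.

Fact agree_mul N p q f g :
  agree N p f -> agree N q g -> agree N (p * q) (fps_mul f g).
Proof.
move=> pf qg n nN; rewrite coefM; apply: eq_bigr => i _.
by rewrite pf ?qg //; have := ltn_ord i; lia.
Qed.

Lemma agree_trunc N f : agree N (\poly_(i < N.+1) f i) f.
Proof. by move=> n nN; rewrite coef_poly ltnS nN. Qed.

Fact fps_mulA : associative fps_mul.
Proof.
move=> f g h; apply: fpsP => n.
have [[F G] H] := (agree_trunc (N := n) f, agree_trunc (N := n) g,
                 agree_trunc (N := n) h).
rewrite -(agree_mul F (agree_mul G H)) // -(agree_mul (agree_mul F G) H) //.
by rewrite mulrA.
Qed.
Fact fps_mulC : commutative fps_mul.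
Proof.
move=> f g; apply: fpsP => n.
have [F G] := (agree_trunc (N := n) f, agree_trunc (N := n) g).
by rewrite -(agree_mul F G) // -(agree_mul G F) // mulrC.
Qed.
Fact fps_mul1 : left_id (fps_of_poly 1) fps_mul.
Proof.
move=> f; apply: fpsP => n; have F := agree_trunc (N := n) f.
have O : agree n 1 (fps_of_poly 1) by [].
by rewrite -(agree_mul O F) // mul1r F.
Qed.
Fact fps_mulDl : left_distributive fps_mul fps_add.
Proof.
move=> f g h; apply: fpsP => n /=.
by rewrite -big_split; apply: eq_bigr => i _; rewrite mulrDl.
Qed.
Fact fps_oner_neq0 : fps_of_poly 1 != 0 :> fps R.
Proof.
apply/eqP => /(congr1 (fun f : fps R => f 0%N)) /=; rewrite coef1 /=.
by move/eqP; rewrite oner_eq0.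
Qed.

HB.instance Definition _ := GRing.Zmodule_isComNzRing.Build (fps R)
  fps_mulA fps_mulC fps_mul1 fps_mulDl fps_oner_neq0.

Lemma fpsD f g n : (f + g) n = f n + g n. Proof. by []. Qed.
Lemma fpsN f n : (- f) n = - f n. Proof. by []. Qed.
Lemma fpsB f g n : (f - g) n = f n - g n. Proof. by []. Qed.
Lemma fps0 n : (0 : fps R) n = 0. Proof. by []. Qed.
Lemma fps1 n : (1 : fps R) n = (n == 0%N)%:R. Proof. by rewrite /= coef1. Qed.
Lemma fpsM f g n : (f * g) n = \sum_(i < n.+1) f i * g (n - i)%N.
Proof. by []. Qed.
Lemma fpsMn f k n : (f *+ k) n = f n *+ k.
Proof. by elim: k => // k IH; rewrite !mulrS fpsD IH. Qed.
Lemma fps_sum I (r : seq I) (P : pred I) (F : I -> fps R) n :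
  (\sum_(i <- r | P i) F i) n = \sum_(i <- r | P i) F i n.
Proof. by elim/big_rec2: _ => // i x y _ <-. Qed.

Lemma agreeM N p q f g : agree N p f -> agree N q g -> agree N (p * q) (f * g).
Proof. exact: agree_mul. Qed.

Fact fps_of_poly_is_additive : zmod_morphism fps_of_poly.
Proof. by move=> p q; apply: fpsP => n /=; rewrite coefB. Qed.
Fact fps_of_poly_is_multiplicative : monoid_morphism fps_of_poly.
Proof.
split=> // p q; apply: fpsP => n.
by apply: (@agreeM n p q) => //.
Qed.
HB.instance Definition _ :=
  GRing.isZmodMorphism.Build {poly R} (fps R) fps_of_poly fps_of_poly_is_additive.
HB.instance Definition _ :=
  GRing.isMonoidMorphism.Build {poly R} (fps R) fps_of_poly
    fps_of_poly_is_multiplicative.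

Definition fpsC (c : R) : fps R := fps_of_poly c%:P.

Lemma fpsCM c f n : (fpsC c * f) n = c * f n.
Proof.
have F := agree_trunc (N := n) f.
have C : agree n c%:P (fpsC c) by [].
by rewrite -(agreeM C F) // coefCM F.
Qed.

(** The Euler operator x d/dx: a derivation that preserves degrees, so that its iterates multiply
    coefficient n by powers of n. *)
Definition fps_deriv f : fps R := Fps (fun n => n%:R * f n).

Lemma agree_deriv N p f : agree N p f -> agree N ('X * p^`()) (fps_deriv f).
Proof.
move=> pf [|n] nN; rewrite coefXM /= ?mul0r //.
by rewrite coef_deriv pf // mulr_natl.
Qed.

Lemma fps_derivD f g : fps_deriv (f + g) = fps_deriv f + fps_deriv g.
Proof. by apply: fpsP => n /=; rewrite mulrDr. Qed.
Lemma fps_derivN f : fps_deriv (- f) = - fps_deriv f.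
Proof. by apply: fpsP => n /=; rewrite mulrN. Qed.
Lemma fps_derivB f g : fps_deriv (f - g) = fps_deriv f - fps_deriv g.
Proof. by rewrite fps_derivD fps_derivN. Qed.
Lemma fps_derivMn f k : fps_deriv (f *+ k) = fps_deriv f *+ k.
Proof. by apply: fpsP => n /=; rewrite !fpsMn /= mulrnAr. Qed.
Lemma fps_deriv_poly p : fps_deriv (fps_of_poly p) = fps_of_poly ('X * p^`()).
Proof.
have A (n : nat) : agree n p (fps_of_poly p) by [].
by apply: fpsP => n; rewrite -(agree_deriv (@A n)).
Qed.
Lemma fps_derivM f g : fps_deriv (f * g) = fps_deriv f * g + f * fps_deriv g.
Proof.
apply: fpsP => n; have [F G] := (agree_trunc (N := n) f, agree_trunc (N := n) g).
rewrite -(agree_deriv (agreeM F G)) // derivM mulrDr fpsD.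
rewrite -(agreeM (agree_deriv F) G) // -(agreeM F (agree_deriv G)) //.
by rewrite coefD mulrA [in X in _ + X]mulrCA.
Qed.
Lemma fps_deriv1 : fps_deriv 1 = 0.
Proof. by apply: fpsP => -[|n]; rewrite /= coef1 ?mul0r ?mulr0. Qed.
Lemma fps_derivX f k : fps_deriv (f ^+ k) = f ^+ k.-1 * fps_deriv f *+ k.
Proof.
elim: k => [|[|k] IH]; first by rewrite expr0 fps_deriv1.
  by rewrite expr1 expr0 mul1r.
by rewrite [in LHS]exprS fps_derivM IH /= mulrnAr mulrA -exprS [_ * f ^+ _]mulrC -mulrS.
Qed.

(** The substitution f(x) |-> f(x^2), in which the doubling formulas are expressed. *)
Definition fps_dbl f : fps R := Fps (fun n => if (2 %| n)%N then f (n %/ 2)%N else 0).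

Lemma fps_dblE f n :
  fps_dbl f n = if (2 %| n)%N then f (n %/ 2)%N else 0.
Proof. by []. Qed.

Lemma fps_derivE f n : fps_deriv f n = n%:R * f n.
Proof. by []. Qed.

Lemma agree_dbl N p f : agree N p f -> agree N (p \Po 'X^2) (fps_dbl f).
Proof.
move=> pf n nN /=; rewrite coef_comp_poly_Xn //.
by case: ifP => // _; rewrite pf // (leq_trans (leq_div _ _)).
Qed.

Fact fps_dbl_is_additive : zmod_morphism fps_dbl.
Proof. by move=> f g; apply: fpsP => n /=; case: ifP; rewrite ?subr0. Qed.
Fact fps_dbl_is_multiplicative : monoid_morphism fps_dbl.
Proof.
split.
  apply: fpsP => n /=; case: ifP => [/dvdnP[k ->]|/negP n2]; rewrite !coef1.
    by rewrite mulnK // muln_eq0 orbF.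
  by case: eqP n2 => // ->; rewrite dvdn0.
move=> f g; apply: fpsP => n.
have [F G] := (agree_trunc (N := n) f, agree_trunc (N := n) g).
rewrite -(agree_dbl (agreeM F G)) // comp_polyM.
by rewrite (agreeM (agree_dbl F) (agree_dbl G)).
Qed.
HB.instance Definition _ :=
  GRing.isZmodMorphism.Build (fps R) (fps R) fps_dbl fps_dbl_is_additive.
HB.instance Definition _ :=
  GRing.isMonoidMorphism.Build (fps R) (fps R) fps_dbl fps_dbl_is_multiplicative.

Lemma fps_deriv_dbl f : fps_deriv (fps_dbl f) = fps_dbl (fps_deriv f) *+ 2.
Proof.
apply: fpsP => n; rewrite fpsMn /=; case: ifP => [/dvdnP[k ->]|_].
  by rewrite mulnK // natrM mulrAC mulr_natr.
by rewrite mulr0 mul0rn.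
Qed.

Lemma fps_dbl_inj : injective fps_dbl.
Proof.
move=> f g E; apply: fpsP => n.
by have /= := congr1 (fun h : fps R => h (n * 2)%N) E; rewrite dvdn_mull // mulnK.
Qed.

Definition vanish k f := forall i, (i < k)%N -> f i = 0.

Lemma vanishM j k f g : vanish j f -> vanish k g -> vanish (j + k) (f * g).
Proof.
move=> vf vg n njk; rewrite fpsM big1 // => i _.
have [ij|ij] := ltnP i j; first by rewrite vf ?mul0r.
by rewrite vg ?mulr0 //; have := ltn_ord i; lia.
Qed.

Lemma vanishX j f k : vanish j f -> vanish (k * j) (f ^+ k).
Proof.
move=> vf; elim: k => [|k IH]; first by [].
by rewrite exprS mulSn; apply: vanishM.
Qed.

Lemma fpsM_lead j k f g : vanish j f -> vanish k g -> (f * g) (j + k)%N = f j * g k.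
Proof.
move=> vf vg; have jlt : (j < (j + k).+1)%N by rewrite ltnS leq_addr.
rewrite fpsM (bigD1 (Ordinal jlt)) //= addKn big1 ?addr0 // => i /eqP ij.
have [lij|leji] := ltnP i j; first by rewrite vf ?mul0r.
have {}ij : (i : nat) <> j by move=> E; apply: ij; apply: val_inj.
by rewrite vg ?mulr0 //; have := ltn_ord i; lia.
Qed.

Lemma fpsX_lead j f k : vanish j f -> (f ^+ k) (k * j)%N = f j ^+ k.
Proof.
move=> vf; elim: k => [|k IH]; first by rewrite fps1.
by rewrite !exprS mulSn fpsM_lead ?IH //; apply: vanishX.
Qed.

Lemma fps_inv_exists f : f 0%N = 1 -> exists g, g * f = 1.
Proof.
move=> f0; pose h := 1 - f.
have vh : vanish 1 h by case=> // _; rewrite fpsB f0 fps1 subrr.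
have hX k n : (n < k)%N -> (h ^+ k) n = 0.
  by move=> nk; have := @vanishX 1 h k vh; rewrite muln1; apply.
(* Partial sums of the geometric series of 1 / (1 - h). Coefficient n is stationary from [G n] on,
   so the diagonal is the inverse. *)
pose G N := \sum_(k < N.+1) h ^+ k.
exists (Fps (fun n => G n n)); apply: fpsP => n.
have GE N i : (i <= N)%N -> G N i = G i i.
  elim: N => [|N IH]; first by rewrite leqn0 => /eqP ->.
  rewrite leq_eqVlt => /predU1P[->//|iN].
  by rewrite {1}/G big_ord_recr fpsD hX // addr0 -IH.
transitivity ((G n * f) n).
  by rewrite !fpsM; apply: eq_bigr => i _; rewrite (GE n) // -ltnS.
have -> : G n * f = 1 - h ^+ n.+1.
  have := subrX1 h n.+1; rewrite -/(G n) => E.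
  have -> : f = - (h - 1) by rewrite /h; ring.
  by rewrite mulrN mulrC -E; ring.
by rewrite fpsB hX // subr0.
Qed.

End FpsRing.

(** * Lattice sums *)

(** The series of f(s, t) x^(s^2 + t^2) over Z^2. Indexing by [sq_pairs] makes weight 1 produce the
    numbers [r2]. *)
Definition lattice_sum (f : int -> int -> rat) : fps rat :=
  Fps (fun n => \sum_(z <- fset_set (sq_pairs n)) f z.1 z.2).

Definition int_box (n : nat) : seq int := [seq i%:Z - n%:Z | i <- iota 0 n.*2.+1].

Arguments int_box n : simpl never.

(** The series of chi(m) x^(m^2) over all integers m; [int_box n] contains every m with m^2 = n. *)
Definition theta (chi : int -> rat) : fps rat :=
  Fps (fun n => \sum_(m <- int_box n | m ^+ 2 == n%:Z) chi m).

Lemma mem_int_box n m : (m \in int_box n) = (`|m| <= n)%N.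
Proof.
apply/mapP/idP => [[i]|mn]; first by rewrite mem_iota => ilt ->; lia.
by exists (absz (m + n%:Z)); [rewrite mem_iota; lia | lia].
Qed.

Lemma int_box_uniq n : uniq (int_box n).
Proof. by rewrite map_inj_uniq ?iota_uniq // => i j; lia. Qed.

Lemma mem_sq_pairs n z :
  (z \in fset_set (sq_pairs n)) = (z.1 ^+ 2 + z.2 ^+ 2 == n%:Z).
Proof.
rewrite in_fset_set; last exact: finite_sq_pairs.
by apply/idP/eqP; rewrite inE.
Qed.

Lemma thetaE N chi n : (n <= N)%N ->
  theta chi n = \sum_(m <- int_box N | m ^+ 2 == n%:Z) chi m.
Proof.
move=> nN; rewrite /= -big_filter -[RHS]big_filter; apply: perm_big.
apply: uniq_perm; rewrite ?filter_uniq ?int_box_uniq // => m.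
by rewrite !mem_filter !mem_int_box; case: eqP => //= e; apply/idP/idP; nia.
Qed.

Lemma lattice_sumE f n : lattice_sum f n =
  \sum_(i <- int_box n) \sum_(j <- int_box n | i ^+ 2 + j ^+ 2 == n%:Z) f i j.
Proof.
under eq_bigr do rewrite big_mkcond.
transitivity (\sum_(z <- [seq (i, j) | i <- int_box n, j <- int_box n])
    if z.1 ^+ 2 + z.2 ^+ 2 == n%:Z then f z.1 z.2 else 0);
  last by rewrite big_allpairs.
rewrite -big_mkcond -[RHS]big_filter; apply: perm_big; apply: uniq_perm.
- exact: fset_uniq.
- rewrite filter_uniq // allpairs_uniq ?int_box_uniq //.
  by case=> [a b] [c d] _ _.
move=> [i j]; rewrite mem_filter mem_sq_pairs /fst /snd; case: eqP => // e.
by apply/esym/allpairsPdep; exists i, j; rewrite !mem_int_box; split=> //; nia.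
Qed.

Lemma thetaM chi psi :
  theta chi * theta psi = lattice_sum (fun i j => chi i * psi j).
Proof.
apply: fpsP => n; rewrite fpsM lattice_sumE.
pose c (A : bool) (x : rat) := if A then x else 0.
(* The Cauchy index k is forced to be i^2, so exchanging the sums eliminates it. *)
transitivity (\sum_(k < n.+1) \sum_(i <- int_box n) \sum_(j <- int_box n)
    c (i ^+ 2 == k%:Z) (chi i) * c (j ^+ 2 == (n - k)%N%:Z) (psi j)).
  apply: eq_bigr => k _; rewrite (@thetaE n) ?(@thetaE n _ (n - k)) ?leq_subr //.
    by rewrite big_mkcond [X in _ * X]big_mkcond big_distrlr.
  by rewrite -ltnS.
rewrite exchange_big; apply: eq_bigr => i _.
rewrite exchange_big [RHS]big_mkcond; apply: eq_bigr => j _; rewrite /c.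
have [e|ne] := eqVneq.
  have ilt : (`|i| ^ 2 < n.+1)%N by nia.
  rewrite (bigD1 (Ordinal ilt)) //= big1 => [|k /eqP nk].
    by rewrite addr0 !ifT //; apply/eqP; nia.
  rewrite ifF ?mul0r //; apply/eqP => ik; apply: nk; apply: val_inj => /=; nia.
rewrite big1 // => k _; case: eqP => [e1|]; rewrite ?mul0r //.
case: eqP => [e2|]; rewrite ?mulr0 //; case/eqP: ne.
by have := ltn_ord k; lia.
Qed.

Lemma eq_lattice_sum f g :
  (forall i j, f i j = g i j) -> lattice_sum f = lattice_sum g.
Proof. by move=> fg; apply: fpsP => n /=; apply: eq_bigr. Qed.

Lemma lattice_sumD f g :
  lattice_sum f + lattice_sum g = lattice_sum (fun i j => f i j + g i j).
Proof. by apply: fpsP => n; rewrite /= big_split. Qed.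

Lemma lattice_sumN f : - lattice_sum f = lattice_sum (fun i j => - f i j).
Proof. by apply: fpsP => n; rewrite /= sumrN. Qed.

(* The rotation (s, t) |-> (s + t, s - t) doubles the norm and maps Z^2 onto   *)
(* the pairs of equal parity.                                                  *)
Lemma lattice_sum_rot f :
    (forall i j, ((i + j) %% 2)%Z = 1 -> f i j = 0) ->
  lattice_sum f = fps_dbl (lattice_sum (fun s t => f (s + t) (s - t))).
Proof.
move=> f_odd; apply: fpsP => n /=; case: ifP => [/dvdnP[k ->]|/negP n_odd].
  rewrite mulnK // (bigID (fun z : int * int => ((z.1 + z.2) %% 2)%Z == 0)) /=.
  rewrite [X in _ + X]big1 ?addr0 => [|z ?]; last by apply: f_odd; lia.
  pose rho (z : int * int) := (z.1 + z.2, z.1 - z.2).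
  rewrite -(big_map rho xpredT (fun z => f z.1 z.2)) -big_filter.
  apply: perm_big; apply: uniq_perm.
  - by rewrite filter_uniq ?fset_uniq.
  - by rewrite map_inj_uniq ?fset_uniq // => -[a b] [c d] []; move=> *; congr pair; lia.
  move=> [i j]; rewrite mem_filter mem_sq_pairs /=.
  apply/andP/mapP => [[/eqP ij /eqP e]|[[s t]]]; last first.
    by rewrite mem_sq_pairs /= => /eqP e [-> ->]; split; apply/eqP; [lia|nia].
  exists (((i + j) %/ 2)%Z, ((i - j) %/ 2)%Z); last by rewrite /rho /=; congr pair; lia.
  rewrite mem_sq_pairs /=; apply/eqP; set s := divz _ _; set t := divz _ _.
  have [Ei Ej] : i = s + t /\ j = s - t by split; lia.
  have : (s ^+ 2 + t ^+ 2) * 2 = i ^+ 2 + j ^+ 2 by rewrite Ei Ej; ring.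
  by rewrite e; clear; lia.
rewrite big_seq big1 // => -[i j]; rewrite mem_sq_pairs /= => /eqP e.
apply: f_odd; apply: contra_notP n_odd => ij.
have : (2 %| n%:Z)%Z by rewrite -e; have -> : i = j + ((i - j) %/ 2)%Z * 2; [lia|nia].
by lia.
Qed.

(** * Theta constants *)

Definition res4 (r n : int) : rat := ((n %% 4)%Z == r)%:R.

Definition chi2 (n : int) := res4 1 n + res4 3 n.
Definition chi3 (n : int) := res4 0 n + res4 2 n.
Definition chi4 (n : int) := res4 0 n - res4 2 n.
Definition chi_odd (n : int) := res4 1 n - res4 3 n.

(* With q = x^4, these are the Jacobi theta constants theta_1', theta_2,       *)
(* theta_3, theta_4 at q.                                                      *)
Definition theta1 := theta (fun n => n%:~R * chi_odd n).
Definition theta2 := theta chi2.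
Definition theta3 := theta chi3.
Definition theta4 := theta chi4.

Lemma mod4P (n : int) :
  [\/ (n %% 4)%Z = 0, (n %% 4)%Z = 1, (n %% 4)%Z = 2 | (n %% 4)%Z = 3].
Proof.
by have : [|| (n %% 4)%Z == 0, (n %% 4)%Z == 1, (n %% 4)%Z == 2 | (n %% 4)%Z == 3];
  [lia | case/or4P => /eqP ->; [constructor 1|constructor 2|constructor 3|constructor 4]].
Qed.

Lemma deriv_theta chi :
  fps_deriv (theta chi) = theta (fun n => n%:~R ^+ 2 * chi n).
Proof.
apply: fpsP => n; rewrite /= mulr_sumr; apply: eq_bigr => m /eqP e.
by congr (_ * _); rewrite -rmorphXn /= e.
Qed.

Lemma theta_odd chi : (forall n, chi (- n) = - chi n) -> theta chi = 0.
Proof.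
move=> chi_odd; apply: fpsP => n; rewrite fps0 /=.
set S := (X in X = 0); suff : S = - S.
  by move=> E; have := mulrn_eq0 S 2; rewrite mulr2n {1}E addNr eqxx /= => /esym/eqP.
rewrite {1}/S -sumrN -[LHS]big_filter.
rewrite (perm_big [seq - m | m <- int_box n & m ^+ 2 == n%:Z]); last first.
  apply: uniq_perm; first by rewrite filter_uniq ?int_box_uniq.
    by rewrite map_inj_uniq ?filter_uniq ?int_box_uniq //; apply: oppr_inj.
  move=> m; rewrite mem_filter mem_int_box; apply/idP/mapP.
    move=> mP; exists (- m); last by rewrite opprK.
    by rewrite mem_filter sqrrN mem_int_box abszN.
  by case=> k; rewrite mem_filter mem_int_box => kP ->; rewrite sqrrN abszN.
by rewrite big_map big_filter; apply: eq_bigr => m _; apply: chi_odd.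
Qed.

(** The rotation reduces a doubling formula to a pointwise identity of weights, checked on all
    residues of s and t mod 4. The second branch checks that the original weight vanishes on pairs
    of opposite parity. *)
Ltac rotate_theta :=
  let s := fresh "s" in let t := fresh "t" in
  let ij := fresh "ij" in let Ei := fresh "Ei" in let Ej := fresh "Ej" in
  rewrite lattice_sum_rot; [
    congr fps_dbl; apply: eq_lattice_sum => s t;
    rewrite /chi2 /chi3 /chi4 /chi_odd /res4 -(modzDm s t) -(modzDm s (- t)) -(modzNm t);
    case: (mod4P s) => ->; case: (mod4P t) => ->; rewrite /= ?rmorphD ?rmorphB ?rmorphN /=; ring
  | move=> s t ij; rewrite /chi2 /chi3 /chi4 /chi_odd /res4;
    case: (mod4P s) => Ei; case: (mod4P t) => Ej; rewrite Ei Ej /=;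
    first [exfalso; lia | ring] ].

Lemma theta3_sqr : theta3 ^+ 2 = fps_dbl (theta3 ^+ 2 + theta2 ^+ 2).
Proof. by rewrite !expr2 !thetaM lattice_sumD; rotate_theta. Qed.

Lemma theta4_sqr : theta4 ^+ 2 = fps_dbl (theta3 ^+ 2 - theta2 ^+ 2).
Proof. by rewrite !expr2 !thetaM lattice_sumN lattice_sumD; rotate_theta. Qed.

Lemma theta2_sqr : theta2 ^+ 2 = fps_dbl (theta2 * theta3) *+ 2.
Proof.
have -> : fps_dbl (theta2 * theta3) *+ 2 = fps_dbl (theta2 * theta3 + theta3 * theta2).
  by rewrite mulr2n rmorphD /= [theta3 * _]mulrC.
by rewrite !expr2 !thetaM lattice_sumD; rotate_theta.
Qed.

Lemma theta_chi_odd : theta chi_odd = 0.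
Proof.
apply: theta_odd => n; rewrite /chi_odd /res4 -modzNm.
by case: (mod4P n) => ->; rewrite /=; ring.
Qed.

Lemma theta3M4 : theta3 * theta4 = fps_dbl (theta4 ^+ 2).
Proof.
(* The rotated weight is chi4(s) chi4(t) + chi_odd(s) chi_odd(t); adding this zero term makes the
   comparison pointwise. *)
have -> : theta4 ^+ 2 = theta4 * theta4 + theta chi_odd * theta chi_odd.
  by rewrite theta_chi_odd mulr0 addr0.
by rewrite !thetaM lattice_sumD; rotate_theta.
Qed.

(** Under the rotation the factor t^2 - s^2 becomes -4 s t. Pairs of odd integers then give
    theta1^2, and pairs of even ones give [t4 * t4], which vanishes because its weight is odd. *)
Lemma theta34_wronskian :
  theta3 * fps_deriv theta4 - theta4 * fps_deriv theta3 =
  - fps_dbl (theta1 ^+ 2) *+ 4.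
Proof.
pose t4 := theta (fun n => n%:~R * chi4 n).
have t4_0 : t4 = 0.
  apply: theta_odd => n; rewrite /chi4 /res4 -modzNm.
  by case: (mod4P n) => ->; rewrite rmorphN /=; ring.
have -> : - fps_dbl (theta1 ^+ 2) *+ 4 = fps_dbl
    (- (theta1 * theta1 + t4 * t4 + (theta1 * theta1 + t4 * t4)
       + (theta1 * theta1 + t4 * t4 + (theta1 * theta1 + t4 * t4)))).
  by rewrite t4_0 -rmorphN -rmorphMn /=; congr fps_dbl; ring.
rewrite [theta4 * _]mulrC !deriv_theta !thetaM lattice_sumN !lattice_sumD
  lattice_sumN.
by rotate_theta.
Qed.

Lemma theta1_sqr : theta1 ^+ 2 =
  fps_dbl (theta3 * fps_deriv theta2 - theta2 * fps_deriv theta3) *+ 2.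
Proof.
(* The rotated weight is symmetric in s and t: it is the square of the odd one minus the square of
   the even one. Hence the symmetrization. *)
have -> : fps_dbl (theta3 * fps_deriv theta2 - theta2 * fps_deriv theta3) *+ 2 =
  fps_dbl (theta3 * fps_deriv theta2 + fps_deriv theta2 * theta3 +
    - (theta2 * fps_deriv theta3 + fps_deriv theta3 * theta2)).
  by rewrite -rmorphMn /=; congr fps_dbl; ring.
rewrite expr2 !deriv_theta !thetaM !lattice_sumD lattice_sumN !lattice_sumD.
by rotate_theta.
Qed.

(** A second rotation turns the weight of theta3^2 - theta2^2 into (-1)^(s + t), making theta4^2 a
    signed generating series of r_2 in x^4. *)
Lemma theta4_sqrE : theta4 ^+ 2 =
  fps_dbl (fps_dbl (lattice_sum (fun s t => chi3 (s + t) - chi2 (s + t)))).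
Proof.
rewrite theta4_sqr; congr fps_dbl.
rewrite !expr2 !thetaM lattice_sumN lattice_sumD lattice_sum_rot.
  congr fps_dbl; apply: eq_lattice_sum => s t.
  rewrite /chi2 /chi3 /res4 -(modzDm s t) -(modzDm s (- t)) -(modzNm t).
  by case: (mod4P s) => ->; case: (mod4P t) => ->; rewrite /=; ring.
move=> s t st; rewrite /chi2 /chi3 /res4.
by case: (mod4P s) => Es; case: (mod4P t) => Et; rewrite Es Et /=;
  first [exfalso; lia | ring].
Qed.

Lemma signed_r2E n :
  lattice_sum (fun s t => chi3 (s + t) - chi2 (s + t)) n = (-1) ^+ n * (r2 n)%:R.
Proof.
rewrite /lattice_sum /= big_seq (eq_bigr (fun=> (-1) ^+ n)).
  by rewrite -big_seq big_const_seq count_predT iter_addr_0 mulr_natr.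
move=> [s t]; rewrite mem_sq_pairs /= => /eqP e.
rewrite -signr_odd /chi3 /chi2 /res4.
(* Since x (1 - x) is even, s + t has the parity of s^2 + t^2 = n. *)
have [st|st] : (odd n /\ ((s + t) %% 2)%Z = 1) \/ (~~ odd n /\ ((s + t) %% 2)%Z = 0).
- have ev (x : int) : (2 %| x * (1 - x))%Z.
    have [h|h] : (2 %| x)%Z \/ (2 %| 1 - x)%Z by lia.
      exact: dvdz_mulr.
    exact: dvdz_mull.
  have : (2 %| s + t - n%:Z)%Z.
    rewrite -e; have -> : s + t - (s ^+ 2 + t ^+ 2) = s * (1 - s) + t * (1 - t) by ring.
    by rewrite rpredD ?ev.
  by lia.
- by case: st => -> st; case: (mod4P (s + t)) => E; rewrite E /=; first [exfalso; lia | ring].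
by case: st => /negPf -> st; case: (mod4P (s + t)) => E; rewrite E /=; first [exfalso; lia | ring].
Qed.

Lemma theta4_sqr_coef m : (theta4 ^+ 2) (4 * m)%N = (-1) ^+ m * (r2 m)%:R.
Proof.
rewrite -signed_r2E theta4_sqrE /=.
by rewrite !ifT; try lia; congr (\sum_(_ <- fset_set (sq_pairs _)) _); lia.
Qed.

Lemma theta4_sqr_coef0 n : ~~ (4 %| n)%N -> (theta4 ^+ 2) n = 0.
Proof.
move=> n4; rewrite theta4_sqrE /=; case: ifP => // n2; case: ifP => // n22; lia.
Qed.

(** * Jacobi's derivative formula and the Halphen system *)

Lemma fps_mulIn k : injective (fun f : fps rat => f *+ k.+1).
Proof.
move=> f g /(congr1 (@fcoef rat)) E; apply: fpsP => n.
have := congr1 (@^~ n) E; rewrite !fpsMn => /eqP.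
by rewrite eqr_pMn2r // => /eqP.
Qed.

Lemma theta3_0 : theta3 0%N = 1.
Proof. by rewrite /= /int_box /= big_cons big_nil. Qed.

Lemma theta4_0 : theta4 0%N = 1.
Proof. by rewrite /= /int_box /= big_cons big_nil. Qed.

Lemma vanish_theta2 : vanish 1 theta2.
Proof. by case=> // _; rewrite /= /int_box /= big_cons big_nil. Qed.

Lemma theta2_1 : theta2 1%N = 2.
Proof. by rewrite /= /int_box /= !big_cons big_nil. Qed.

Lemma vanish_theta1 : vanish 1 theta1.
Proof. by case=> // _; rewrite /= /int_box /= big_cons big_nil. Qed.

Lemma theta1_1 : theta1 1%N = 2.
Proof. by rewrite /= /int_box /= !big_cons big_nil. Qed.

(** Evaluates 2 theta3 theta4 (theta3 D theta4 - theta4 D theta3) twice: by [theta3M4] and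
    [theta34_wronskian], and by differentiating the doubling formulas of theta3^2 and theta4^2. *)
Lemma theta1_doubling :
  theta2 ^+ 2 * theta1 ^+ 2 = fps_dbl (theta4 ^+ 2 * theta1 ^+ 2) *+ 4.
Proof.
have E3 : theta3 * fps_deriv theta3 *+ 2 =
    fps_dbl (theta3 * fps_deriv theta3 + theta2 * fps_deriv theta2) *+ 4.
  have := congr1 (@fps_deriv _) theta3_sqr.
  rewrite fps_deriv_dbl fps_derivD !fps_derivX !expr1 -mulrnDl rmorphMn => ->.
  by rewrite -mulrnA.
have E4 : theta4 * fps_deriv theta4 *+ 2 =
    fps_dbl (theta3 * fps_deriv theta3 - theta2 * fps_deriv theta2) *+ 4.
  have := congr1 (@fps_deriv _) theta4_sqr.
  rewrite fps_deriv_dbl fps_derivB !fps_derivX !expr1 -mulrnBl rmorphMn => ->.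
  by rewrite -mulrnA.
apply: (@fps_mulIn 1).
have -> : fps_dbl (theta4 ^+ 2 * theta1 ^+ 2) *+ 4 *+ 2 =
    - (fps_dbl (theta4 ^+ 2) * (- fps_dbl (theta1 ^+ 2) *+ 4) *+ 2).
  by rewrite rmorphM; ring.
rewrite -theta3M4 -theta34_wronskian.
transitivity (theta4 ^+ 2 * (theta3 * fps_deriv theta3 *+ 2) -
              theta3 ^+ 2 * (theta4 * fps_deriv theta4 *+ 2)); last by ring.
rewrite E3 E4 theta1_sqr theta2_sqr {1}theta3_sqr {1}theta4_sqr.
rewrite !(rmorphB, rmorphD, rmorphM, rmorphXn) /=.
ring.
Qed.

(** If f starts in degree n, the left side has coefficient 4 f_n in degree n + 2, while the right
    side only sees degree (n + 2) / 2, which is below n once n >= 3. Degree 2 is fixed by this map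
    and must be checked by hand. *)
Lemma theta2_doubling_eq0 (f : fps rat) :
  theta2 ^+ 2 * f = fps_dbl (theta4 ^+ 2 * f) *+ 4 -> vanish 3 f -> f = 0.
Proof.
move=> E v3; apply: fpsP => n; have [/v3 //|] := ltnP n 3.
elim/ltn_ind: n => n IH n3.
have vn : vanish n f.
  by move=> i ni; have [/v3 //|i3] := ltnP i 3; apply: IH.
have v2 := @vanishX _ 1 theta2 2 vanish_theta2.
have := congr1 (fun h : fps rat => h (2 + n)%N) E.
rewrite (fpsM_lead v2 vn) (@fpsX_lead _ 1 _ 2 vanish_theta2) theta2_1 fpsMn fps_dblE.
case: ifP => [_|_ /eqP]; last by rewrite mul0rn mulf_eq0 /= => /eqP.
have -> : (theta4 ^+ 2 * f) ((2 + n) %/ 2)%N = 0.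
  by apply: (@vanishM _ 0 n) => //; lia.
by move/eqP; rewrite mul0rn mulf_eq0 /= => /eqP.
Qed.

(** Jacobi's derivative formula, squared: both sides satisfy the same doubling equation and start
    with 4 x^2. *)
Lemma theta1E : theta1 ^+ 2 = (theta2 * theta3 * theta4) ^+ 2.
Proof.
apply/eqP; rewrite -subr_eq0; apply/eqP; apply: theta2_doubling_eq0.
  rewrite mulrBr theta1_doubling mulrBr rmorphB mulrnBl; congr (_ - _).
  have -> : theta2 ^+ 2 * (theta2 * theta3 * theta4) ^+ 2 =
    (theta2 ^+ 2) ^+ 2 * (theta3 * theta4) ^+ 2 by ring.
  by rewrite theta2_sqr theta3M4 !(rmorphM, rmorphXn) /=; ring.
have v1 := @vanishX _ 1 _ 2 vanish_theta1.
have v2 := @vanishX _ 1 _ 2 vanish_theta2.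
have v0 (f : fps rat) : vanish 0 f by [].
rewrite -mulrA exprMn => n n3; rewrite fpsB.
have [n2|n2] := ltnP n 2.
  by rewrite v1 // (@vanishM _ 2 0 _ _ v2 (v0 _)) // subr0.
have -> : n = 2%N by lia.
have -> := @fpsX_lead _ 1 _ 2 vanish_theta1.
have -> := @fpsM_lead _ 2 0 _ ((theta3 * theta4) ^+ 2) v2 (v0 _).
have -> := @fpsX_lead _ 1 _ 2 vanish_theta2.
rewrite (@fpsX_lead _ 0 _ 2 (v0 _)) (@fpsM_lead _ 0 0 _ _ (v0 _) (v0 _)).
by rewrite theta1_1 theta2_1 theta3_0 theta4_0.
Qed.

Lemma theta34_deriv :
  theta3 * fps_deriv theta4 - theta4 * fps_deriv theta3 =
  - (theta2 ^+ 4 * theta3 * theta4).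
Proof.
rewrite theta34_wronskian theta1E.
have -> : theta2 ^+ 4 * theta3 * theta4 = (theta2 ^+ 2) ^+ 2 * (theta3 * theta4) by ring.
by rewrite theta2_sqr theta3M4 !(rmorphM, rmorphXn) /=; ring.
Qed.

Lemma theta23_deriv :
  theta3 * fps_deriv theta2 - theta2 * fps_deriv theta3 =
  theta2 * theta3 * theta4 ^+ 4.
Proof.
apply: fps_dbl_inj; apply: (@fps_mulIn 1); rewrite /= -theta1_sqr theta1E.
have -> : (theta2 * theta3 * theta4) ^+ 2 = theta2 ^+ 2 * (theta3 * theta4) ^+ 2 by ring.
by rewrite theta2_sqr theta3M4 !(rmorphM, rmorphXn) /=; ring.
Qed.

(** This is (A + B)^2 = 4 A B + (A - B)^2 at x^2, with A = theta3^2 and B = theta2^2. *)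
Lemma theta_quartic : theta3 ^+ 4 = theta2 ^+ 4 + theta4 ^+ 4.
Proof.
have X4 (f : fps rat) : f ^+ 4 = (f ^+ 2) ^+ 2 by ring.
rewrite !X4 theta2_sqr theta3_sqr theta4_sqr.
by rewrite !(rmorphB, rmorphD, rmorphM, rmorphXn) /=; ring.
Qed.

Lemma fps_dbl_eq0 (f : fps rat) : f = fps_dbl f *+ 4 -> f = 0.
Proof.
move=> E; apply: fpsP => n; elim/ltn_ind: n => n IH.
rewrite E fpsMn fps_dblE; case: ifP => _; last by rewrite mul0rn.
have [-> | n0] := eqVneq n 0%N; last by rewrite IH ?mul0rn //; lia.
rewrite div0n; have := congr1 (fun h : fps rat => h 0%N) E.
by rewrite fpsMn fps_dblE dvdn0 div0n fps0 => E0; lra.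
Qed.

(* A rescaled Halphen system for the logarithmic derivatives a, b, d of        *)
(* theta4, theta3, theta2. The defect of its last equation satisfies           *)
(* f = 4 f(x^2), hence vanishes.                                               *)
Lemma theta_halphen : exists a b d : fps rat,
  [/\ fps_deriv theta4 = a * theta4, fps_deriv theta3 = b * theta3,
      fps_deriv theta2 = d * theta2,
      (b - a = theta2 ^+ 4 /\ d - a = theta3 ^+ 4) &
      fps_deriv a = (a * b + a * d - b * d) *+ 2].
Proof.
have [i3 I3] := fps_inv_exists theta3_0; have [i4 I4] := fps_inv_exists theta4_0.
pose a := fps_deriv theta4 * i4; pose b := fps_deriv theta3 * i3.
pose d := b + theta4 ^+ 4.
have Da : fps_deriv theta4 = a * theta4 by rewrite /a -mulrA I4 mulr1.
have Db : fps_deriv theta3 = b * theta3 by rewrite /b -mulrA I3 mulr1.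
have ba : b - a = theta2 ^+ 4.
  have := theta34_deriv; rewrite Da Db => E.
  transitivity ((i3 * theta3) * (i4 * theta4) * (b - a)); first by rewrite I3 I4; ring.
  transitivity (- (i3 * i4 * (theta3 * (a * theta4) - theta4 * (b * theta3)))); first by ring.
  by rewrite E -[RHS]mulr1 -I3 -[RHS]mulr1 -I4; ring.
have Dd : fps_deriv theta2 = d * theta2.
  have := theta23_deriv; rewrite Db => E.
  rewrite -[LHS]mul1r -I3 -mulrA; move: E => /(canRL (subrK _)) ->.
  transitivity ((i3 * theta3) * (d * theta2)); first by rewrite /d; ring.
  by rewrite I3 mul1r.
have da : d - a = theta3 ^+ 4 by rewrite theta_quartic -ba /d; ring.
exists a, b, d; split=> //; clearbody d; clearbody a b.
(* The logarithmic derivative of [theta3M4]. *)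
have Sa : a + b = fps_dbl a *+ 4.
  have := congr1 (@fps_deriv _) theta3M4.
  rewrite fps_deriv_dbl fps_derivM fps_derivX Da Db expr1.
  have -> : theta4 * (a * theta4) *+ 2 = theta4 ^+ 2 * (a *+ 2) by ring.
  rewrite rmorphM /= -theta3M4 => E.
  transitivity ((i3 * theta3) * (i4 * theta4) * (a + b)); first by rewrite I3 I4; ring.
  transitivity (i3 * i4 * (b * theta3 * theta4 + theta3 * (a * theta4))); first by ring.
  rewrite E rmorphMn /= -[RHS]mulr1 -I3 -[RHS]mulr1 -I4; ring.
apply/eqP; rewrite -subr_eq0; apply/eqP; apply: fps_dbl_eq0.
(* As a b + a d - b d = a^2 - (b - a) (d - a), Delta at x^2 involves only a, D a and theta2 theta3
   at x^2. These are converted back to x by [Sa], [DSa] and [theta2_sqr]. *)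
set Delta := LHS.
have DSa : fps_deriv a + fps_deriv b = fps_dbl (fps_deriv a) *+ 8.
  by rewrite -fps_derivD Sa fps_derivMn fps_deriv_dbl -mulrnA.
have Dba : fps_deriv b = fps_deriv a + (b - a) * d *+ 4.
  rewrite -[b in LHS](subrK a) ba fps_derivD fps_derivX Dd /=; ring.
have Sba : fps_dbl b = fps_dbl a + fps_dbl (theta2) ^+ 4.
  by rewrite -rmorphXn -ba /= rmorphB /=; ring.
have Sda : fps_dbl d = fps_dbl a + fps_dbl (theta3) ^+ 4.
  by rewrite -rmorphXn -da /= rmorphB /=; ring.
have S23 : (fps_dbl theta2 * fps_dbl theta3) ^+ 4 *+ 16 = (b - a) ^+ 2.
  rewrite ba -rmorphM /=; transitivity ((fps_dbl (theta2 * theta3) *+ 2) ^+ 4); first by ring.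
  by rewrite -theta2_sqr; ring.
apply: (@fps_mulIn 1) => /=.
have -> : fps_dbl Delta *+ 4 *+ 2 =
    fps_dbl (fps_deriv a) *+ 8 - (fps_dbl a *+ 4) ^+ 2
    + (fps_dbl theta2 * fps_dbl theta3) ^+ 4 *+ 16.
  by rewrite /Delta !(rmorphB, rmorphD, rmorphM, rmorphMn) /= Sba Sda; ring.
by rewrite -DSa -Sa S23 Dba /Delta; ring.
Qed.

(* u, g, e stand for lambda = theta2^4 / theta3^4, theta3^-4 and theta4^-2.    *)
Lemma modular_system : exists u g e beta : fps rat,
  [/\ [/\ g 0%N = 1, beta 0%N = 0, e * theta4 ^+ 2 = 1,
          vanish 4 u & u 4%N = 16],
      g * fps_deriv u = u * (1 - u) *+ 4,
      g * fps_deriv e = beta * e,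
      g * fps_deriv g = beta * g *+ 2 - u * g *+ 4 &
      g * fps_deriv beta = beta ^+ 2 + u *+ 4 - u * beta *+ 4].
Proof.
have [a [b [d [Da Db Dd [ba da] Ha]]]] := theta_halphen.
have [i3 I3] := fps_inv_exists theta3_0; have [i4 I4] := fps_inv_exists theta4_0.
have v0 (f : fps rat) : vanish 0 f by [].
have i3_0 : i3 0%N = 1.
  have := congr1 (fun h : fps rat => h 0%N) I3.
  by rewrite (@fpsM_lead _ 0 0 _ _ (v0 _) (v0 _)) theta3_0 mulr1 fps1.
have Dinv (f i k : fps rat) : i * f = 1 -> fps_deriv f = k * f -> fps_deriv i = - (k * i).
  move=> If Df; have := congr1 (@fps_deriv _) If.
  rewrite fps_deriv1 fps_derivM Df => E.
  rewrite -[LHS]mulr1 -If; transitivity ((fps_deriv i * f + i * (k * f)) * i - k * i * (i * f)).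
    by ring.
  by rewrite E If; ring.
pose g := i3 ^+ 4; pose e := i4 ^+ 2.
have Dg : fps_deriv g = - (b * g *+ 4).
  by rewrite /g fps_derivX (Dinv _ _ _ I3 Db) /=; ring.
have De : fps_deriv e = - (a * e *+ 2).
  by rewrite /e fps_derivX (Dinv _ _ _ I4 Da) /=; ring.
have gd : g * (d - a) = 1 by rewrite da /g -exprMn I3 expr1n.
have g0 : g 0%N = 1 by rewrite /g (@fpsX_lead _ 0 _ 4 (v0 _)) i3_0 expr1n.
have a0 : a 0%N = 0.
  have := congr1 (fun h : fps rat => h 0%N) Da.
  rewrite (@fpsM_lead _ 0 0 _ _ (v0 _) (v0 _)) theta4_0 mulr1 => <-.
  by rewrite fps_derivE mul0r.
(* Here beta is g times the logarithmic derivative of e = theta4^-2, that is, -2 a g. *)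
exists (theta2 ^+ 4 * g), g, e, (- (a * g *+ 2)); split; last first.
- rewrite fps_derivN fps_derivMn fps_derivM Ha Dg -ba.
  rewrite -[in X in _ = _ + X - _](mulr1 ((b - a) * g)) -gd; ring.
- by rewrite Dg -ba; ring.
- by rewrite De; ring.
- rewrite fps_derivM fps_derivX Dd Dg /=.
  transitivity (theta2 ^+ 4 * g ^+ 2 * ((d - a) - (b - a)) *+ 4); first by ring.
  by rewrite -gd ba; ring.
split=> //.
- by rewrite fpsN fpsMn (@fpsM_lead _ 0 0 _ _ (v0 _) (v0 _)) a0 mul0r mul0rn oppr0.
- by rewrite /e -exprMn I4 expr1n.
- by apply: (@vanishM _ 4 0 _ _ _ (v0 _)); apply: (@vanishX _ 1 _ 4 vanish_theta2).
rewrite (@fpsM_lead _ 4 0 _ _ _ (v0 _)) ?g0; last exact: (@vanishX _ 1 _ 4 vanish_theta2).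
by rewrite (@fpsX_lead _ 1 _ 4 vanish_theta2) theta2_1.
Qed.

(** * The closed form *)

(** The number of placements of i non-attacking rooks on an n x n board. *)
Definition wgt (n i : nat) : nat := (i`! * 'C(n, i) ^ 2)%N.

Lemma wgt_recS n i : (i <= n)%N ->
  wgt n.+1 i.+1 = (wgt n i.+1 + (n - i + n.+1) * wgt n i)%N.
Proof.
move=> le_in; rewrite /wgt binS factS.
have := mul_bin_left n i; move: (binomial n i.+1) (binomial n i) => x y E.
have -> : (i.+1 * i`! * (x + y) ^ 2 = i`! * (i.+1 * x ^ 2 + (2 * (i.+1 * x) + i.+1 * y) * y))%N by ring.
rewrite E; have -> : n.+1 = (n - i + i.+1)%N by lia.
by ring.
Qed.

Lemma wgt_recSr n i : (i.+1 * wgt n.+1 i.+1 = n.+1 ^ 2 * wgt n i)%N.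
Proof.
rewrite /wgt factS; have := mul_bin_diag n.+1 i => /= E.
have -> : (i.+1 * (i.+1 * i`! * 'C(n.+1, i.+1) ^ 2) = i`! * (i.+1 * 'C(n.+1, i.+1)) ^ 2)%N by ring.
by rewrite -E; ring.
Qed.

Section ExplicitFormula.
Variables (u g e beta c : fps rat).
Hypothesis gDe : g * fps_deriv e = beta * e.
Hypothesis gDg : g * fps_deriv g = beta * g *+ 2 - u * g *+ 4.
Hypothesis gDbeta :
  g * fps_deriv beta = beta ^+ 2 + u *+ 4 - u * beta *+ 4.

Let t j i := g ^+ j * beta ^+ i * iter j (@fps_deriv _) c.

Definition rc_sum n := \sum_(i < n.+1) t (n - i) i *+ wgt n i.

Lemma gD_expg j : g * fps_deriv (g ^+ j) = (beta *+ 2 - u *+ 4) * g ^+ j *+ j.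
Proof.
rewrite fps_derivX; case: j => [|j]; first by rewrite !mulr0n mulr0.
rewrite mulrnAr; congr (_ *+ _); rewrite mulrCA gDg exprS; ring.
Qed.

Lemma gD_expbeta i : g * fps_deriv (beta ^+ i) =
  (beta ^+ i.+1 + u * beta ^+ i.-1 *+ 4 - u * beta ^+ i *+ 4) *+ i.
Proof.
rewrite fps_derivX; case: i => [|i]; first by rewrite !mulr0n mulr0.
rewrite mulrnAr; congr (_ *+ _); rewrite mulrCA gDbeta /= !exprS; ring.
Qed.

(** The factor i + 2 j + 1 collects i from beta^i, 2 j from g^j and 1 from e. *)
Lemma gD_term j i : g * fps_deriv (e * t j i) =
  e * (t j i.+1 *+ (i + j + j.+1) - u * t j i *+ (4 * (j + i))
       + u * t j i.-1 *+ (4 * i) + t j.+1 i).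
Proof.
rewrite /t !fps_derivM /= -/(fps_deriv _).
transitivity ((g * fps_deriv e) * (g ^+ j * beta ^+ i * iter j (@fps_deriv _) c)
  + e * ((g * fps_deriv (g ^+ j)) * beta ^+ i * iter j (@fps_deriv _) c
  + g ^+ j * (g * fps_deriv (beta ^+ i)) * iter j (@fps_deriv _) c
  + g * g ^+ j * beta ^+ i * fps_deriv (iter j (@fps_deriv _) c))); first by ring.
rewrite gDe gD_expg gD_expbeta.
rewrite !exprS; move: (iter j _ c) (fps_deriv _) (beta ^+ i.-1) (beta ^+ i) (g ^+ j).
by clear; move=> x y z b k; ring.
Qed.

(** In the sum of [gD_term] over i + j = n, the terms in u t(j, i) cancel against 4 n u, those in u
    t(j, i - 1) reassemble by [wgt_recSr] into the sum for n - 1, and the others by [wgt_recS] into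
    the sum for n + 1. *)
Lemma rc_sum_rec n : e * rc_sum n.+1 =
  g * fps_deriv (e * rc_sum n) + u * (e * rc_sum n) *+ (4 * n)
  - u * (e * rc_sum n.-1) *+ (4 * n ^ 2).
Proof.
have -> : g * fps_deriv (e * rc_sum n) =
    \sum_(i < n.+1) g * fps_deriv (e * t (n - i) i) *+ wgt n i.
  rewrite /rc_sum mulr_sumr.
  elim/big_rec2: _ => [|i x y _ <-].
    by rewrite (_ : fps_deriv 0 = 0) ?mulr0 //; apply: fpsP => k; rewrite fps_derivE fps0 mulr0.
  by rewrite fps_derivD mulrnAr fps_derivMn mulrDr mulrnAr.
under eq_bigr => i _ do rewrite gD_term -mulrnAr !mulrnDl mulNrn.
rewrite -mulr_sumr !big_split /= sumrN.
have -> : \sum_(i < n.+1) u * t (n - i) i *+ (4 * (n - i + i)) *+ wgt n i =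
    u * rc_sum n *+ (4 * n).
  rewrite mulr_sumr -sumrMnl; apply: eq_bigr => i _.
  rewrite subnK; last by rewrite -ltnS.
  rewrite [in RHS]mulrnAr -!mulrnA; congr (_ *+ _).
  exact: mulnC.
have -> : \sum_(i < n.+1) u * t (n - i) i.-1 *+ (4 * i) *+ wgt n i =
    u * rc_sum n.-1 *+ (4 * n ^ 2).
  case: n => [|n]; first by rewrite big_ord1 /= !mulr0n mul0rn.
  rewrite big_ord_recl /= mulr0n mul0rn add0r mulr_sumr -sumrMnl.
  apply: eq_bigr => i _; have -> : bump 0 i = i.+1 by [].
  rewrite subSS add0n mulrnAr -!mulrnA; congr (_ *+ _).
  by rewrite -mulnA wgt_recSr; ring.
have -> : rc_sum n.+1 = \sum_(i < n.+1) t (n - i) i.+1 *+ (i + (n - i) + (n - i).+1) *+ wgt n i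
    + \sum_(i < n.+1) t (n - i).+1 i *+ wgt n i.
  rewrite /rc_sum [LHS]big_ord_recl [X in _ = _ + X]big_ord_recl /= !subn0 addrCA.
  congr (_ + _); first by rewrite /wgt !bin0.
  have B0 (k : nat) : bump 0 k = k.+1 by [].
  have W (i : 'I_n.+1) := @wgt_recS n i (ltn_ord i).
  under eq_bigr => i _ do rewrite B0 subSS W mulrnDr.
  rewrite big_split /= [LHS]addrC; congr (_ + _).
    apply: eq_bigr => i _; rewrite -mulrnA; congr (_ *+ (_ * _)).
    by have := ltn_ord i; lia.
  rewrite big_ord_recr /= {2}/wgt bin_small // muln0 mulr0n addr0.
  by apply: eq_bigr => i _; rewrite B0 subnSK.
move: (rc_sum n) (rc_sum n.-1) (\sum_(i < _) _) (\sum_(i < _) _) => x y z w.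
by clear; ring.
Qed.

End ExplicitFormula.

(** * Evaluation of the polynomials P_n at a power series *)

Lemma sum_ord_trunc (V : nmodType) (F : nat -> V) (m n : nat) :
    (forall i, (m <= i)%N -> F i = 0) -> (forall i, (n <= i)%N -> F i = 0) ->
  \sum_(i < m) F i = \sum_(i < n) F i.
Proof.
wlog le_mn : m n / (m <= n)%N => [H Fm Fn | Fm _].
  by have [mn|/ltnW nm] := leqP m n; [apply: H | symmetry; apply: H].
rewrite -!(big_mkord xpredT F) (@big_cat_nat _ _ _ m 0 n) //=.
by rewrite [X in _ + X]big_nat [X in _ + X]big1 ?addr0 // => i /andP[/Fm].
Qed.

Lemma iter_fps_derivE (R : comNzRingType) (f : fps R) j n :
  iter j (@fps_deriv R) f n = n%:R ^+ j * f n.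
Proof. by elim: j => [|j IH]; rewrite ?mul1r // iterS fps_derivE IH exprS mulrA. Qed.

Section Evaluation.
Variables (R : comNzRingType) (u : fps R).

Definition fps_eval (q : {poly R}) : fps R :=
  (map_poly (@fps_of_poly R \o polyC) q).[u].

Lemma fps_evalD q r : fps_eval (q + r) = fps_eval q + fps_eval r.
Proof. by rewrite /fps_eval rmorphD hornerD. Qed.
Lemma fps_evalN q : fps_eval (- q) = - fps_eval q.
Proof. by rewrite /fps_eval rmorphN hornerN. Qed.
Lemma fps_evalM q r : fps_eval (q * r) = fps_eval q * fps_eval r.
Proof. by rewrite /fps_eval rmorphM hornerM. Qed.
Lemma fps_evalX : fps_eval 'X = u.
Proof. by rewrite /fps_eval map_polyX hornerX. Qed.
Lemma fps_evalC c : fps_eval c%:P = fpsC c.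
Proof. by rewrite /fps_eval map_polyC hornerC. Qed.

Lemma fps_eval_deriv q :
  fps_deriv (fps_eval q) = fps_eval q^`() * fps_deriv u.
Proof.
have DC c : fps_deriv (fpsC c : fps R) = 0.
  by rewrite /fpsC fps_deriv_poly derivC mulr0 rmorph0.
elim/poly_ind: q => [|q c IH].
  by rewrite deriv0 -polyC0 fps_evalC DC /fpsC polyC0 rmorph0 mul0r.
rewrite derivD derivM derivX derivC addr0 mulr1 !fps_evalD !fps_evalM fps_evalX.
by rewrite fps_evalC fps_derivD DC addr0 fps_derivM IH; ring.
Qed.

(** As u^i starts in degree (k + 1) i or later, only i <= N can reach degree (k + 1) N. *)
Lemma fps_eval_coef q k N : vanish k.+1 u ->
  fps_eval q (k.+1 * N)%N = \sum_(i < N.+1) q`_i * (u ^+ i) (k.+1 * N)%N.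
Proof.
move=> vu; rewrite /fps_eval horner_coef fps_sum.
rewrite (@sum_ord_trunc _ (fun i => ((map_poly (@fps_of_poly R \o polyC) q)`_i *
    u ^+ i) (k.+1 * N)%N) _ N.+1).
- by apply: eq_bigr => i _; rewrite coef_map -fpsCM.
- by move=> i /leq_sizeP -> //; rewrite mul0r.
move=> i lt_Ni; rewrite coef_map -[X in X * _]/(fpsC _) fpsCM.
by rewrite (@vanishX _ k.+1 _ i vu) ?mulr0 //; rewrite mulnC; nia.
Qed.

End Evaluation.

Definition scaled (p : int -> {poly rat}) (n : nat) : {poly rat} :=
  (n`!%:R ^+ 2) *: p n%:Z.

Section Recurrence.
Variable p : int -> {poly rat}.
Hypothesis p_m1 : p (- 1) = 0.
Hypothesis p_0 : p 0 = 1.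
Hypothesis p_rec : forall n : nat,
  (n%:R + 1) ^+ 2 *: p (n%:Z + 1) + (p n%:Z)^`() * ('X^2 - 'X)
    - n%:R *: ('X * p n%:Z) + 4%:R^-1 *: ('X * p (n%:Z - 1)) = 0.

(** At n = 0 the truncated [n.-1] puts P_0 in the last term where the recurrence has p_(-1) = 0; the
    factor n^2 makes the two agree. *)
Lemma scaled_rec n : scaled p n.+1 = (scaled p n)^`() * ('X - 'X^2)
  + n%:R *: ('X * scaled p n) - (n%:R ^+ 2 / 4%:R) *: ('X * scaled p n.-1).
Proof.
have := p_rec n; rewrite /scaled derivZ.
have -> : n%:Z + 1 = n.+1%:Z by lia.
set q := p n.+1 => H.
have {H} E : (n%:R + 1) ^+ 2 *: q = (p n%:Z)^`() * ('X - 'X^2)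
    + n%:R *: ('X * p n%:Z) - 4%:R^-1 *: ('X * p (n%:Z - 1)).
  apply/eqP; rewrite -subr_eq0 -[X in _ == X]H -!mul_polyC; apply/eqP; ring.
have -> : n.+1`!%:R ^+ 2 *: q = n`!%:R ^+ 2 *: ((n%:R + 1) ^+ 2 *: q).
  by rewrite scalerA factS natrM exprMn -natr1 [_ ^+ 2 * _]mulrC.
rewrite E; case: n q E => [|n] q _.
  have -> : 0%:Z - 1 = - 1 by [].
  by rewrite p_m1 p_0 /= !mulr0 -!mul_polyC; ring.
have -> : n.+1%:Z - 1 = n%:Z by lia.
rewrite /= factS natrM -!mul_polyC !(rmorphM, rmorphXn) /=.
by move: (p n) (p n.+1)^`() (p n.+1) => x y z; ring.
Qed.

(** By g D u = 4 u (1 - u) and the chain rule, [scaled_rec] becomes the recurrence of [rc_sum_rec]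
    for 4^n P_n(u); e c = 1 starts the induction. *)
Lemma scaled_eval (u g e beta c : fps rat) (n : nat) :
    e * c = 1 -> g * fps_deriv u = u * (1 - u) *+ 4 ->
    g * fps_deriv e = beta * e ->
    g * fps_deriv g = beta * g *+ 2 - u * g *+ 4 ->
    g * fps_deriv beta = beta ^+ 2 + u *+ 4 - u * beta *+ 4 ->
  fps_eval u (scaled p n) *+ 4 ^ n = e * rc_sum g beta c n.
Proof.
move=> ec gDu gDe gDg gDb.
elim/ltn_ind: n => -[|n] IH.
  rewrite /scaled p_0 expr1n scale1r -polyC1 fps_evalC /fpsC polyC1 rmorph1.
  by rewrite /rc_sum big_ord1 /wgt !expr0 !mul1r bin0 ec.
rewrite (rc_sum_rec c gDe gDg gDb) -!IH //; last by case: n {IH} => //= n; apply: leqW.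
rewrite fps_derivMn mulrnAr fps_eval_deriv mulrCA gDu.
rewrite scaled_rec -!mul_polyC [in 'X ^+ 2]expr2 !(fps_evalD, fps_evalN, fps_evalM, fps_evalC, fps_evalX).
have Cn : fpsC n%:R = n%:R :> fps rat by rewrite /fpsC !rmorph_nat.
have C4 : fpsC (n%:R ^+ 2 / 4%:R) *+ 4 = n%:R ^+ 2 :> fps rat.
  rewrite /fpsC -!rmorphMn /= -mulr_natr divfK //.
  by rewrite !rmorphXn !rmorph_nat.
rewrite Cn; move: (fpsC (n%:R ^+ 2 / 4%:R)) C4 => k C4.
move: (fps_eval u (scaled p n)^`()) (fps_eval u (scaled p n)) => x y.
have -> : u * (fps_eval u (scaled p n.-1) *+ 4 ^ n.-1) *+ (4 * n ^ 2) =
    n%:R ^+ 2 * u * fps_eval u (scaled p n.-1) *+ 4 ^ n.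
  case: n {IH Cn C4} => [|n]; first by rewrite mulr0n expr0n !mul0r mul0rn.
  rewrite succnK; move: (fps_eval u _) => z.
  by rewrite -mulnn expnS; move: (4 ^ n)%N n.+1 => w N; ring.
rewrite -C4 expnS; move: (4 ^ n)%N (fps_eval u _) => w z; ring.
Qed.

End Recurrence.

(** * The exponential part of the coefficients *)

Lemma fpsXnM (R : comNzRingType) i (f : fps R) n :
  (fps_of_poly 'X^i * f) n = if (n < i)%N then 0 else f (n - i)%N.
Proof.
have F := agree_trunc (N := n) f.
have X : agree n 'X^i (fps_of_poly 'X^i : fps R) by [].
rewrite -(agreeM X F) // coefXnM; case: ifP => // _.
by rewrite F ?leq_subr.
Qed.

(** The generating series of s is rational, regular at 0 and at every 1/k with k >= m. Asking this
    for all such k, not only k = m, lets the induction reuse smaller indices. *)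
Definition tame (m : nat) (s : nat -> rat) : Prop :=
  exists a b : {poly rat},
    [/\ b.[0] != 0, forall k : nat, (0 < k)%N -> (m <= k)%N -> b.[k%:R^-1] != 0
      & fps_of_poly b * Fps s = fps_of_poly a].

Lemma eq_tame m s t : s =1 t -> tame m s -> tame m t.
Proof. by move=> /funext ->. Qed.

Lemma tame_poly m (q : {poly rat}) : tame m (fun n => q`_n).
Proof.
exists q, 1; split=> [|k _ _|]; rewrite ?hornerC ?oner_eq0 //.
by rewrite rmorph1 mul1r.
Qed.

Lemma tame0 m : tame m (fun=> 0).
Proof. by apply: eq_tame (tame_poly m 0) => n; rewrite coef0. Qed.

Lemma tameS m m' s : (m <= m')%N -> tame m s -> tame m' s.
Proof.
move=> le_mm' [a [b [b0 bk E]]]; exists a, b; split=> // k k0 m'k.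
by apply: bk => //; apply: leq_trans m'k.
Qed.

Lemma tameD m s t : tame m s -> tame m t -> tame m (fun n => s n + t n).
Proof.
move=> [a [b [b0 bk E]]] [a' [b' [b0' bk' E']]].
exists (a * b' + a' * b), (b * b'); split=> [|k k0 mk|].
- by rewrite hornerM mulf_neq0.
- by rewrite hornerM mulf_neq0 ?bk ?bk'.
rewrite !(rmorphD, rmorphM) /= -E -E'.
have -> : Fps (fun n => s n + t n) = Fps s + Fps t by [].
ring.
Qed.

Lemma tame_polyM m (q : {poly rat}) s :
  tame m s -> tame m (fps_of_poly q * Fps s).
Proof.
move=> [a [b [b0 bk E]]]; exists (q * a), b; split=> //.
have -> (f : fps rat) : Fps f = f by case: f.
by rewrite rmorphM /= -E; ring.
Qed.

Lemma tameZ m c s : tame m s -> tame m (fun n => c * s n).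
Proof.
by move=> /(tame_polyM c%:P); apply: eq_tame => n; rewrite -[LHS]/((fpsC c * _) n) fpsCM.
Qed.

Lemma tameB m s t : tame m s -> tame m t -> tame m (fun n => s n - t n).
Proof.
move=> hs /(tameZ (-1)) ht; apply: eq_tame (tameD hs ht) => n.
by rewrite mulN1r.
Qed.

Lemma tame_sum m N (s : nat -> nat -> rat) :
  (forall i, (i < N)%N -> tame m (s i)) -> tame m (fun n => \sum_(i < N) s i n).
Proof.
elim: N => [|N IH] hs.
  by apply: eq_tame (tame0 m) => n; rewrite big_ord0.
have := tameD (IH (fun i iN => hs i (leqW iN))) (hs N (ltnSn N)).
by apply: eq_tame => n; rewrite big_ord_recr.
Qed.

Lemma tame_shift m i s :
  tame m s -> tame m (fun n => if (n < i)%N then 0 else s (n - i)%N).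
Proof.
move=> [a [b [b0 bk E]]]; exists ('X^i * a), b; split=> //.
rewrite rmorphM /= -E mulrCA; congr (_ * _); apply: fpsP => n.
by rewrite fpsXnM.
Qed.

Lemma tame_natM m s : tame m s -> tame m (fun n => n%:R * s n).
Proof.
move=> [a [b [b0 bk E]]].
exists (b * ('X * a^`()) - 'X * b^`() * a), (b ^+ 2); split=> [|k k0 mk|].
- by rewrite horner_exp expf_neq0.
- by rewrite horner_exp expf_neq0 ?bk.
have -> : Fps (fun n => n%:R * s n) = fps_deriv (Fps s) by [].
have D (q : {poly rat}) :
    fps_of_poly 'X * fps_of_poly q^`() = fps_deriv (fps_of_poly q : fps rat).
  by rewrite fps_deriv_poly rmorphM.
rewrite !(rmorphB, rmorphM, rmorphXn) /= !D -E.
rewrite fps_derivM; ring.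
Qed.

Lemma tame_binM m i s : tame m s -> tame m (fun n => 'C(n, i)%:R * s n).
Proof.
move=> hs; elim: i => [|i IH].
  by apply: eq_tame hs => n; rewrite bin0 mul1r.
have := tameZ (i.+1%:R^-1) (tameB (tame_natM IH) (tameZ i%:R IH)).
apply: eq_tame => n; rewrite -mulrBl.
have [le_in|lt_ni] := leqP i n; last first.
  by rewrite !bin_small ?(leqW lt_ni) // !mul0r !mulr0.
have E : (n%:R - i%:R) * 'C(n, i)%:R = i.+1%:R * 'C(n, i.+1)%:R :> rat.
  by rewrite -natrB // -!natrM mul_bin_left.
by rewrite [X in _ * X = _]mulrA E -mulrA mulKf // pnatr_eq0.
Qed.

Lemma fps_geom (k : rat) :
  fps_of_poly (1 - k *: 'X) * Fps (fun n => k ^+ n) = 1.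
Proof.
rewrite rmorphB rmorph1 mulrBl mul1r -mul_polyC rmorphM /= -mulrA.
apply: fpsP => n; rewrite fpsB fps1 -[fps_of_poly _]/(fpsC _) fpsCM.
rewrite -['X]expr1 fpsXnM; case: n => [|n]; first by rewrite /= mulr0 subr0.
by rewrite /= subSS subn0 exprS subrr.
Qed.


Lemma tame_geom m k : (k < m)%N -> tame m (fun n => k%:R ^+ n).
Proof.
move=> km; exists 1, (1 - k%:R *: 'X); split=> [|j j0 mj|].
- by rewrite !hornerE ?mulr0 ?subr0 ?oner_eq0.
- rewrite !hornerE subr_eq0 eq_sym; apply/eqP => /(congr1 ( *%R^~ j%:R)).
  rewrite mul1r divfK ?pnatr_eq0 -?lt0n // => /eqP; rewrite eqr_nat => /eqP; lia.
by rewrite rmorph1 fps_geom.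
Qed.

Section ExponentialPart.
Variables (m : nat) (c g e beta : fps rat).
Hypothesis c_supp : forall n, ~~ (4 %| n)%N -> c n = 0.

(** The coefficient c_i contributes (i / 4)^j, and only multiples i = 4 k matter. The subtracted
    term is i = 4 m; all others have base k < m. *)
Lemma tame_mul_deriv (f : fps rat) :
  tame m (fun j => (f * iter j (@fps_deriv _) c) (4 * m)%N / 4%:R ^+ j
                   - f 0%N * c (4 * m)%N * m%:R ^+ j).
Proof.
pose s i j := (i%:R / 4%:R) ^+ j * c i * f (4 * m - i)%N : rat.
apply: (@eq_tame _ (fun j => \sum_(i < 4 * m) s i j)); last first.
  apply: tame_sum => i lt_im; have [/dvdnP[k Ei]|i4] := boolP (4 %| i)%N; last first.
    by apply: eq_tame (tame0 m) => j; rewrite /s c_supp // mulr0 mul0r.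
  have km : (k < m)%N by lia.
  apply: eq_tame (tameZ (c i * f (4 * m - i)%N) (tame_geom km)) => j.
  have -> : k%:R = i%:R / 4%:R :> rat by rewrite Ei natrM mulfK.
  by rewrite /s; ring.
move=> j; apply/eqP; rewrite eq_sym subr_eq; apply/eqP.
transitivity (\sum_(i < (4 * m).+1) s i j).
  rewrite [f * _]mulrC fpsM mulr_suml; apply: eq_bigr => i _.
  by rewrite iter_fps_derivE /s expr_div_n; ring.
rewrite big_ord_recr /=; congr (_ + _).
by rewrite /s subnn natrM [4%:R * _]mulrC mulfK //; ring.
Qed.

Hypothesis g0 : g 0%N = 1.

(** Expand g^j = (1 + h)^j. The term r = 0 is the previous lemma; for r > 0, h^r has zero constant
    term, so no m^j appears, and C(j, r) only raises the order of existing poles. *)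
Lemma tame_mul_expr_deriv (f : fps rat) :
  tame m (fun j => (f * g ^+ j * iter j (@fps_deriv _) c) (4 * m)%N / 4%:R ^+ j
                   - f 0%N * c (4 * m)%N * m%:R ^+ j).
Proof.
pose h := g - 1.
have vh : vanish 1 h by case=> // _; rewrite fpsB g0 fps1 subrr.
pose s r j := (f * h ^+ r * iter j (@fps_deriv _) c) (4 * m)%N / 4%:R ^+ j.
apply: (@eq_tame _ (fun j => s 0%N j - f 0%N * c (4 * m)%N * m%:R ^+ j
    + \sum_(r < 4 * m) 'C(j, r.+1)%:R * s r.+1 j)); last first.
  apply: tameD; first by apply: eq_tame (tame_mul_deriv f) => j; rewrite /s expr0 mulr1.
  apply: (@tame_sum m _ (fun r j => 'C(j, r.+1)%:R * s r.+1 j)) => r _.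
  apply: tame_binM.
  have := tame_mul_deriv (f * h ^+ r.+1).
  have -> : (f * h ^+ r.+1) 0%N = 0.
    by apply: (@vanishM _ 0 (r.+1 * 1)) => //; apply: vanishX.
  by apply: eq_tame => j; rewrite !mul0r subr0.
move=> j; rewrite addrAC; congr (_ - _).
transitivity (\sum_(r < (4 * m).+1) 'C(j, r)%:R * s r j).
  by rewrite big_ord_recl bin0 mul1r.
(* Terms with r > j have C(j, r) = 0, and those with r > 4 m vanish in degree 4 m. The bound 4 m,
   independent of j, is what [tame_sum] needs. *)
rewrite (@sum_ord_trunc _ (fun r => 'C(j, r)%:R * s r j) _ j.+1); last first.
- by move=> r jr; rewrite bin_small // mul0r.
- move=> r mr; rewrite /s; set x := fcoef _ _; suff -> : x = 0 by rewrite mul0r mulr0.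
  rewrite /x -mulrA mulrCA; apply: (@vanishM _ (r * 1) 0) => //; last by lia.
  exact: vanishX.
have -> : g = 1 + h by rewrite /h addrC subrK.
rewrite exprDn mulr_sumr mulr_suml fps_sum mulr_suml; apply: eq_bigr => r _.
rewrite expr1n mul1r [f * _]mulrnAr [X in fcoef X]mulrnAl fpsMn /s.
by rewrite [LHS]mulr_natl [RHS]mulrnAl.
Qed.

Hypothesis beta0 : beta 0%N = 0.
Hypothesis e0 : e 0%N = 1.

(** Only i = 0 contributes m^n: for i > 0, e beta^i has zero constant term, and the weight [wgt n i]
    is polynomial in n. *)
Lemma tame_rc_sum :
  tame m (fun n => (e * rc_sum g beta c n) (4 * m)%N / 4%:R ^+ n
                   - c (4 * m)%N * m%:R ^+ n).
Proof.
have vb : vanish 1 beta by case.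
pose s i n := (e * beta ^+ i * g ^+ (n - i) * iter (n - i) (@fps_deriv _) c)
  (4 * m)%N / 4%:R ^+ n *+ wgt n i.
apply: (@eq_tame _ (fun n => s 0%N n - c (4 * m)%N * m%:R ^+ n
    + \sum_(i < 4 * m) s i.+1 n)); last first.
  apply: tameD.
    apply: eq_tame (tame_mul_expr_deriv e) => n.
    by rewrite /s expr0 mulr1 subn0 /wgt bin0 e0 mul1r.
  apply: (@tame_sum m _ (fun i => s i.+1)) => i _.
  have := tame_mul_expr_deriv (e * beta ^+ i.+1).
  have -> : (e * beta ^+ i.+1) 0%N = 0.
    by apply: (@vanishM _ 0 (i.+1 * 1)) => //; apply: vanishX.
  move/(tame_shift i.+1)/(tame_binM i.+1)/(tame_binM i.+1).
  move/(tameZ (i.+1`!%:R / 4%:R ^+ i.+1)); apply: eq_tame => n.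
  have [lt_ni|le_in] := ltnP n i.+1.
    by rewrite /s /wgt bin_small // muln0 mulr0n !mul0r mulr0.
  have E4 : 4%:R ^+ n = 4%:R ^+ (n - i.+1) * 4%:R ^+ i.+1 :> rat.
    by rewrite -exprD subnK.
  rewrite !mul0r subr0 /s /wgt E4 invfM -[RHS]mulr_natr natrM natrX; ring.
move=> n; rewrite addrAC; congr (_ - _).
transitivity (\sum_(i < (4 * m).+1) s i n); first by rewrite big_ord_recl.
rewrite (@sum_ord_trunc _ (s^~ n) _ n.+1); last first.
- by move=> i ni; rewrite /s /wgt bin_small // muln0 mulr0n.
- move=> i mi; rewrite /s; set x := fcoef _ _; suff -> : x = 0 by rewrite mul0r mul0rn.
  rewrite /x [e * _]mulrC -!mulrA; apply: (@vanishM _ (i * 1) 0) => //; last by lia.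
  exact: vanishX.
rewrite /rc_sum mulr_sumr fps_sum mulr_suml; apply: eq_bigr => i _.
rewrite mulrnAr fpsMn /s [RHS]mulrnAl; congr (fcoef _ _ / _ *+ _).
by rewrite !mulrA; congr (_ * _); rewrite mulrAC.
Qed.

End ExponentialPart.

Lemma tame_scaled_coef (p : int -> {poly rat}) (m : nat) :
    p (- 1) = 0 -> p 0 = 1 ->
    (forall n : nat, (n%:R + 1) ^+ 2 *: p (n%:Z + 1) + (p n%:Z)^`() * ('X^2 - 'X)
      - n%:R *: ('X * p n%:Z) + 4%:R^-1 *: ('X * p (n%:Z - 1)) = 0) ->
  tame m (fun n => (scaled p n)`_m
                   - (-1) ^+ m * (r2 m)%:R / 16%:R ^+ m * m%:R ^+ n).
Proof.
move=> p_m1 p_0 p_rec.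
have [u [g [e [beta [[g0 beta0 ec vu u4] gDu gDe gDg gDb]]]]] := modular_system.
have e0 : e 0%N = 1.
  have := congr1 (fun f : fps rat => f 0%N) ec.
  by rewrite (@fpsM_lead _ 0 0) // (@fpsX_lead _ 0 _ 2) // theta4_0 expr1n mulr1 fps1.
elim/ltn_ind: m => m IH.
have := tame_rc_sum m theta4_sqr_coef0 g0 beta0 e0; rewrite theta4_sqr_coef => hE.
have hS : tame m (fun n => \sum_(i < m) (u ^+ i) (4 * m)%N * (scaled p n)`_i).
  apply: (@tame_sum m _ (fun i n => (u ^+ i) (4 * m)%N * (scaled p n)`_i)) => i im.
  apply: tameZ; apply: (@tameS i.+1) => //.
  (* Restoring the exponential i^n costs a pole at 1/i, still allowed because i < m. *)
  have hi := tameS (leqnSn i) (IH i im).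
  apply: eq_tame (tameD hi (tameZ ((-1) ^+ i * (r2 i)%:R / 16%:R ^+ i)
    (@tame_geom i.+1 i (ltnSn i)))) => n.
  by rewrite subrK.
apply: eq_tame (tameZ (16%:R ^- m) (tameB hE hS)) => n.
have := congr1 (fun f : fps rat => f (4 * m)%N)
  (scaled_eval p_m1 p_0 p_rec n ec gDu gDe gDg gDb).
rewrite fpsMn (@fps_eval_coef _ _ _ 3 m vu) big_ord_recr /= => <-.
have -> : (u ^+ m) (4 * m)%N = 16%:R ^+ m by rewrite mulnC (@fpsX_lead _ 4) // u4.
have -> (x : rat) : x *+ 4 ^ n / 4%:R ^+ n = x.
  by rewrite -[x *+ _]mulr_natr natrX mulfK ?expf_neq0.
have -> : \sum_(i < m) (u ^+ i) (4 * m)%N * (scaled p n)`_i =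
          \sum_(i < m) (scaled p n)`_i * (u ^+ i) (4 * m)%N.
  by apply: eq_bigr => i _; rewrite mulrC.
move: (\sum_(i < m) _) => x; field.
by rewrite expf_neq0.
Qed.

(** * Rational functions and their poles *)

Section Series.
Variable F : fieldType.
Implicit Types (f : {fraction {poly F}}) (s : fps F) (q : {poly F}).

(** Relates a rational function to its Taylor series at 0 through any suitable fraction, avoiding
    the representatives chosen by [rf_num] and [rf_den]; [has_series_taylor] is the bridge. *)
Definition has_series f s := exists a b : {poly F},
  [/\ b.[0] != 0, f = rf_of a / rf_of b & fps_of_poly b * s = fps_of_poly a].

Lemma rf_ofM q r : rf_of (q * r) = rf_of q * rf_of r.
Proof. exact: rmorphM. Qed.

Lemma rf_ofD q r : rf_of (q + r) = rf_of q + rf_of r.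
Proof. exact: rmorphD. Qed.

Lemma horner_rf_neq0 q c : q.[c] != 0 -> rf_of q != 0.
Proof. by move=> qc; apply: rf_of_neq0; apply: contraNneq qc => ->; rewrite horner0. Qed.

Lemma has_seriesD f g s t :
  has_series f s -> has_series g t -> has_series (f + g) (s + t).
Proof.
move=> [a [b [b0 -> E]]] [a' [b' [b0' -> E']]].
exists (a * b' + a' * b), (b * b'); split; first by rewrite hornerM mulf_neq0.
  rewrite rf_ofD !rf_ofM; apply: addf_div; first exact: (horner_rf_neq0 b0).
  exact: (horner_rf_neq0 b0').
by rewrite rmorphD !rmorphM /= -E -E'; ring.
Qed.

Lemma has_seriesM q f s :
  has_series f s -> has_series (rf_of q * f) (fps_of_poly q * s).
Proof.
move=> [a [b [b0 -> E]]]; exists (q * a), b; split=> //.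
  by rewrite rf_ofM mulrA.
by rewrite rmorphM /= -E; ring.
Qed.

Lemma has_series_div q f s t : q.[0] != 0 -> fps_of_poly q * t = s ->
  has_series f s -> has_series (f / rf_of q) t.
Proof.
move=> q0 <- [a [b [b0 -> E]]]; exists a, (b * q); split.
- by rewrite hornerM mulf_neq0.
- by rewrite rf_ofM invfM mulrA.
by rewrite rmorphM /= -E; ring.
Qed.

Lemma has_series_deriv f s :
  has_series f s -> has_series (rf_of 'X * rf_deriv f) (fps_deriv s).
Proof.
move=> [a [b [b0 -> E]]].
have bn0 : b != 0 by apply: contraNneq b0 => ->; rewrite horner0.
exists ('X * (a^`() * b - a * b^`())), (b ^+ 2); split.
- by rewrite horner_exp expf_neq0.
- by rewrite rf_derivE // rf_ofM mulrA.
have -> : 'X * (a^`() * b - a * b^`()) = 'X * a^`() * b - a * ('X * b^`()) by ring.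
rewrite rmorphB /= [X in X - _]rmorphM [X in _ - X]rmorphM rmorphXn /=.
by rewrite -!fps_deriv_poly -E fps_derivM; ring.
Qed.

Lemma has_series_taylor f s n : has_series f s -> taylor_coef 0 f n = s n.
Proof.
move=> [a [b [b0 -> E]]]; rewrite /taylor_coef.
have -> : rf_of b = rf_of (('X - 0%:P) ^+ 0 * b) by rewrite expr0 mul1r.
rewrite laurent_coefE // addr0 polyC0 addr0 !comp_polyXr; symmetry.
apply: psdiv_unique => [|k]; first by rewrite -horner_coef0.
have := congr1 (fun f : fps F => f k) E; rewrite mulrC fpsM => /= <-.
by [].
Qed.

Lemma has_series_regular f s : has_series f s -> regular_at 0 f.
Proof. by move=> [a [b [b0 E _]]]; exists a, b. Qed.

Lemma residue_regular c f : regular_at c f -> residue c f = 0.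
Proof.
move=> [a [b [bc ->]]].
have -> : rf_of b = rf_of (('X - c%:P) ^+ 0 * b) by rewrite expr0 mul1r.
by rewrite /residue laurent_coefE.
Qed.

Lemma residue_simple (c : F) (a b : {poly F}) : b.[c] != 0 ->
  residue c (rf_of a / rf_of (('X - c%:P) * b)) = a.[c] / b.[c].
Proof.
move=> bc; rewrite -['X - c%:P]expr1 /residue laurent_coefE //=.
have H0 q : (q \Po ('X + c%:P))`_0 = q.[c].
  by rewrite -horner_coef0 horner_comp !hornerE.
have := @psdivP _ (a \Po ('X + c%:P)) (b \Po ('X + c%:P)) 0.
rewrite big_ord1 !H0 => /(_ bc) <-; by rewrite mulfK.
Qed.

End Series.

(** * The functions h_n and their residues *)

Lemma r2_eq0 n : (r2 n == 0%N) = ~~ `[< exists a b : int, n%:Z = a ^+ 2 + b ^+ 2 >].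
Proof.
rewrite cardfs_eq0; apply/eqP/idP => [E|/asboolPn H].
  apply/asboolPn => -[a [b e]].
  by have := mem_sq_pairs n (a, b); rewrite E in_fset0 /= e eqxx.
apply/fsetP => -[a b]; rewrite mem_sq_pairs in_fset0; apply/eqP => /= e.
by apply: H; exists a, b.
Qed.

(** The stated recurrence solved for h_n, whose coefficient there is (1 - n v) / v. *)
Fixpoint hrat (n : nat) : {fraction {poly rat}} :=
  if n is k.+1 then
    let v := rf_of 'X in
    v / rf_of (1 - n%:R *: 'X) * (v * rf_deriv (hrat k) - k%:R * hrat k
      - v * rf_deriv (v * rf_deriv (v * hrat k)) / 4%:R)
  else 1.

Lemma horner_1subZX (c x : rat) : (1 - c *: 'X).[x] = 1 - c * x.
Proof. by rewrite !hornerE. Qed.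

Lemma rf_ofC_natV (n : nat) : n%:R != 0 :> rat ->
  rf_of (n%:R^-1)%:P = n%:R^-1 :> {fraction {poly rat}}.
Proof.
move=> n0; have E : rf_of (n%:R)%:P = n%:R :> {fraction {poly rat}}.
  by rewrite /rf_of !rmorph_nat.
have N0 : n%:R != 0 :> {fraction {poly rat}} by rewrite -E rf_of_neq0 // polyC_eq0.
by apply: (mulfI N0); rewrite -{1}E -rf_ofM -polyCM !divff.
Qed.

Section TaylorCoefficients.
Variable p : int -> {poly rat}.
Hypothesis p_m1 : p (- 1) = 0.
Hypothesis p_0 : p 0 = 1.
Hypothesis p_rec : forall n : nat,
  (n%:R + 1) ^+ 2 *: p (n%:Z + 1) + (p n%:Z)^`() * ('X^2 - 'X)
    - n%:R *: ('X * p n%:Z) + 4%:R^-1 *: ('X * p (n%:Z - 1)) = 0.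

Lemma hrat_series n : has_series (hrat n) (Fps (fun j => (scaled p j)`_n)).
Proof.
elim: n => [|n IH].
  exists 1, 1; split; rewrite ?hornerC ?oner_neq0 //.
    by rewrite divff // rf_of_neq0 ?oner_neq0.
  rewrite rmorph1 mul1r; apply: fpsP => j; rewrite fps1 /=.
  (* Every term of the recurrence is divisible by u, so P_j has constant term 0 for j > 0. *)
  elim: j => [|j IHj]; first by rewrite /scaled p_0 expr1n scale1r coef1.
  rewrite (scaled_rec p_m1 p_0 p_rec) -!mul_polyC.
  by rewrite coefB coefD !coefCM !coefXM mulrBr coefB coefMX coefMXn /=; ring.
set s := Fps _ in IH.
have E : fps_of_poly (1 - n.+1%:R *: 'X) * Fps (fun j => (scaled p j)`_n.+1) =
    fps_of_poly 'X * (fps_deriv s + fps_of_poly (- n%:R%:P) * s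
      + fps_of_poly (- (4%:R^-1)%:P) *
        fps_deriv (fps_deriv (fps_of_poly 'X * s))).
  have FC (c : rat) (f : fps rat) j : (fps_of_poly c%:P * f) j = c * f j.
    exact: fpsCM.
  rewrite rmorphB rmorph1 mulrBl mul1r -mul_polyC rmorphM /= -mulrA -!polyCN.
  rewrite -['X]expr1; apply: fpsP => j; rewrite fpsB FC !fpsXnM.
  case: j => [|j]; first by rewrite /= /scaled p_0 expr1n scale1r coef1 mulr0 subr0.
  rewrite ltnS ltn0 subSS subn0 !fpsD !FC !fps_derivE fpsXnM /s /=.
  rewrite (scaled_rec p_m1 p_0 p_rec) -!mul_polyC coefB coefD !coefCM !coefXM /=.
  rewrite mulrBr coefB coefMX coefMXn /= coef_deriv.
  have -> : (if (n.+1 < 2)%N then 0 else ((scaled p j)^`())`_(n.+1 - 2)) = (scaled p j)`_n *+ n.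
    by case: n {IH s} => [|n]; rewrite ?mulr0n // subSS subSS subn0 coef_deriv.
  (* At j = 0 the term written with [j.-1] is multiplied by j^2 = 0. *)
  case: j => [|j]; first by rewrite /= !mul0r; ring.
  by rewrite /= subSS subn0; field.
have IHX := has_seriesM 'X IH.
have := has_seriesD (has_seriesD (has_series_deriv IH) (has_seriesM (- n%:R%:P) IH))
  (has_seriesM (- (4%:R^-1)%:P) (has_series_deriv (has_series_deriv IHX))).
move/(has_seriesM 'X)/(has_series_div _ E); rewrite horner_1subZX mulr0 subr0 oner_neq0.
move/(_ isT); congr has_series; rewrite /=.
have rN q : rf_of (- q) = - rf_of q :> {fraction {poly rat}} by exact: rmorphN.
rewrite !rN rf_ofC_natV // [rf_of n%:R%:P](_ : _ = n%:R); last by rewrite /rf_of !rmorph_nat.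
set y := rf_deriv (_ * rf_deriv _); set x := rf_deriv (hrat n).
set w := (rf_of _)^-1; set v := rf_of 'X; set q := 4%:R^-1; set z := hrat n.
by clearbody x y z w v q; ring.
Qed.

End TaylorCoefficients.

Lemma solve_linear (K : fieldType) (v k x : K) : v != 0 -> 1 - k * v != 0 ->
  v / (1 - k * v) * x / v - k * (v / (1 - k * v) * x) = x.
Proof. by move=> v0 w0; field; rewrite v0 w0. Qed.

Lemma hrat_rec n : (0 < n)%N ->
  let v := rf_of 'X in
  hrat n / v - n%:R * hrat n + (n%:R - 1) * hrat n.-1 - v * rf_deriv (hrat n.-1)
    + v * rf_deriv (v * rf_deriv (v * hrat n.-1)) / 4%:R = 0.
Proof.
case: n => // n _ v; rewrite succnK [hrat n.+1]/=; fold v.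
have v0 : v != 0 by rewrite rf_of_neq0 // polyX_eq0.
have D : rf_of (1 - n.+1%:R *: 'X) = 1 - n.+1%:R * v :> {fraction {poly rat}}.
  rewrite -mul_polyC /v [LHS]rmorphB rmorph1 rmorphM /=; congr (_ - _ * _).
  by rewrite !rmorph_nat.
have w0 : 1 - n.+1%:R * v != 0.
  rewrite -D; apply: (@horner_rf_neq0 _ _ 0).
  by rewrite horner_1subZX mulr0 subr0 oner_neq0.
set x := v * rf_deriv (hrat n); set y := v * rf_deriv _ / _; set z := hrat n.
rewrite D (solve_linear _ v0 w0).
have -> : n.+1%:R - 1 = n%:R :> {fraction {poly rat}} by rewrite -natr1 addrK.
clearbody x y z; ring.
Qed.

(** The hypotheses say h = a / b + k / (1 - n v) with b nonzero at 1/n, and 1 - n v = -n (v -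
    1/n). *)
Lemma series_pole n (h : {fraction {poly rat}}) s (k : rat) : (0 < n)%N ->
    has_series h s -> tame n (fun j => s j - k * n%:R ^+ j) ->
  (regular_at n%:R^-1 h <-> k = 0) /\ residue n%:R^-1 h = - k / n%:R.
Proof.
move=> n0 [A [B [B0 Eh EB]]] [a [b [b0 bk Eb]]].
have nz : n%:R != 0 :> rat by rewrite pnatr_eq0 -lt0n.
have bn : b.[n%:R^-1] != 0 by apply: bk.
pose d : {poly rat} := 1 - n%:R *: 'X.
pose S : fps rat := Fps (fun j => n%:R ^+ j).
pose T : fps rat := Fps (fun j => s j - k * n%:R ^+ j).
have geom : fps_of_poly d * S = 1 by exact: fps_geom.
have dE : d = ('X - (n%:R^-1)%:P) * (- n%:R)%:P.
  by rewrite /d -mul_polyC polyCN mulrN mulrBl -polyCM mulVf // polyC1 opprB [_ * 'X]mulrC.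
have Es : s = T + fpsC k * S by apply: fpsP => j; rewrite fpsD fpsCM /= subrK.
(* The decomposition of h with denominators cleared, obtained by comparing power series. *)
have H : A * (d * b) = (a * d + k%:P * b) * B.
  clearbody d.
  have inj : injective (@fps_of_poly rat).
    by move=> q r /(congr1 (@fcoef rat)) E; apply/polyP => i; have := congr1 (@^~ i) E.
  apply: inj; rewrite !(rmorphM, rmorphD) /= -EB -Eb -/T Es.
  rewrite -[fps_of_poly k%:P]/(fpsC k).
  transitivity (fps_of_poly B * (fps_of_poly b * T * fps_of_poly d
    + fpsC k * (fps_of_poly d * S) * fps_of_poly b)); first by ring.
  by rewrite geom; ring.
have Hh : h = rf_of (a * d + k%:P * b) / rf_of (('X - (n%:R^-1)%:P) * (- n%:R *: b)).
  have -> : ('X - (n%:R^-1)%:P) * (- n%:R *: b) = d * b.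
    by rewrite dE -mul_polyC mulrA.
  have db0 : d * b != 0.
    apply: contraNneq b0 => /(congr1 (fun q => q.[0])).
    by rewrite hornerM horner_1subZX mulr0 subr0 mul1r horner0 => ->.
  rewrite Eh; apply/eqP; rewrite eqr_div ?rf_of_neq0 ?(horner_rf_neq0 B0) //.
    by rewrite -!rf_ofM H.
  by apply: contraNneq B0 => ->; rewrite horner0.
have res : residue n%:R^-1 h = - k / n%:R.
  rewrite Hh residue_simple; last by rewrite hornerZ mulf_neq0 ?oppr_eq0.
  rewrite hornerD !hornerM hornerZ hornerC horner_1subZX divff // subrr mulr0 add0r.
  by rewrite -mulf_div divff // mulr1 invrN mulrN mulNr.
split=> //; split=> [/residue_regular|k0].
  by rewrite res => /eqP; rewrite mulf_eq0 oppr_eq0 invr_eq0 (negPf nz) orbF => /eqP.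
exists a, b; split=> //.
have d0 : rf_of d != 0.
  by apply: (@horner_rf_neq0 _ _ 0); rewrite horner_1subZX mulr0 subr0 oner_neq0.
move: H; rewrite k0 mul0r addr0 => H.
have {}H : A * b = a * B.
  have d0' : d != 0 by apply: contraNneq d0 => ->; rewrite /rf_of rmorph0.
  by apply: (mulIf d0'); rewrite -mulrA [b * d]mulrC H mulrAC.
rewrite Eh; apply/eqP; rewrite eqr_div; last exact: (horner_rf_neq0 bn).
  by rewrite -!rf_ofM H.
exact: (horner_rf_neq0 B0).
Qed.

Theorem theorem2 (p : int -> {poly rat})
    (p_m1 : p (- 1) = 0) (p_0 : p 0 = 1)
    (p_rec : forall n : nat,
       (n%:R + 1) ^+ 2 *: p (n%:Z + 1) + (p n%:Z)^`() * ('X^2 - 'X)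
         - n%:R *: ('X * p n%:Z) + 4%:R^-1 *: ('X * p (n%:Z - 1)) = 0) :
  let v : {fraction {poly rat}} := rf_of 'X in
  exists h : nat -> {fraction {poly rat}},
    [/\ forall n : nat, regular_at 0 (h n),
        forall i j : nat, Hseries p i j = taylor_coef 0 (h i) j,
        h 0%N = 1,
        forall n : nat, (0 < n)%N ->
          h n / v - n%:R * h n + (n%:R - 1) * h n.-1
            - v * rf_deriv (h n.-1)
            + v * rf_deriv (v * rf_deriv (v * h n.-1)) / 4%:R = 0
      & forall n : nat, (1 <= n)%N ->
          (has_pole n%:R^-1 (h n) <->
             exists a b : int, n%:Z = a ^+ 2 + b ^+ 2)
          /\ residue n%:R^-1 (h n)
               = (-1) ^+ n.-1 * (r2 n)%:R / (n%:R * 16%:R ^+ n)].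
Proof.
move=> v; exists hrat; have hS := hrat_series p_m1 p_0 p_rec.
split=> [n|i j||n|n n0].
- exact: has_series_regular (hS n).
- by rewrite (has_series_taylor j (hS i)) /= /scaled coefZ.
- by [].
- exact: hrat_rec.
have [reg res] := series_pole n0 (hS n) (tame_scaled_coef n p_m1 p_0 p_rec).
have nz : n%:R != 0 :> rat by rewrite pnatr_eq0 -lt0n.
split; last first.
  (* The sign of -k / n turns (-1)^n into (-1)^(n - 1). *)
  rewrite res -{1}(prednK n0) exprS invfM; ring.
have -> : (exists a b : int, n%:Z = a ^+ 2 + b ^+ 2) <-> (r2 n != 0%N).
  by rewrite r2_eq0 negbK; split=> /asboolP.
rewrite /has_pole; have -> : regular_at n%:R^-1 (hrat n) <-> r2 n = 0%N.
  rewrite reg; split=> [/eqP|->]; last by rewrite mulr0 mul0r.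
  by rewrite !mulf_eq0 invr_eq0 !expf_eq0 !pnatr_eq0 oppr_eq0 oner_eq0 !andbF !orbF => /eqP.
by split=> [/eqP|/eqP].
Qed.
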